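(* Let $n\ge2$ and $k\in\mathbb{Z}\setminus\{0\}$. Then $(M([1,\lambda^k]),\underline{\lambda^k})$ is an interval Garside monoid with set of simples $\underline{[1,\lambda^k]}$. Its group of fractions exists (and is denoted by $G([1,\lambda^k])$).
   Context: Let $x$ be a transcendental parameter. $G(\infty,\infty,n)$ is the group of $n\times n$ monomial matrices (exactly one nonzero entry in each row and column) all of whose nonzero entries are of the form $x^m$, $m\in\mathbb{Z}$, with product of all nonzero entries equal to $1$. Generating set: $X=\{t_i\ (i\in\mathbb{Z}),\, s_3,\dots,s_n\}$, where $t_i$ is the block diagonal matrix with upper left $2\times2$ block $\begin{pmatrix}0 & x^{-i} \\ x^i & 0\end{pmatrix}$ and lower right block $I_{n-2}$, and $s_j$ ($3\le j\le n$) is the permutation matrix of the transposition $(j-1,j)$. All elements of $X$ are involutions and $X$ generates the group. $\ell(w)$ is the minimal length of a word in elements of $X$ representing $w$. Partial orders: $v\preceq w$ if $\ell(v)+\ell(v^{-1}w)=\ell(w)$, and $v\preceq_r w$ if $\ell(wv^{-1})+\ell(v)=\ell(w)$. $[1,w]=\{v : v\preceq w\}$, $[1,w]_r=\{v : v\preceq_r w\}$; $w$ is balanced if $[1,w]=[1,w]_r$. $\lambda=\mathrm{diag}(x^{-(n-1)},x,\dots,x)\in G(\infty,\infty,n)$. $M([1,\lambda^k])$ is the monoid presented by a generating set $\underline{[1,\lambda^k]}$ in bijection $w\mapsto\underline{w}$ with $[1,\lambda^k]$ and the relations $\underline{w}=\underline{w'}\,\underline{w''}$ whenever $w,w',w''\in[1,\lambda^k]$,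 $w=w'w''$ and $\ell(w)=\ell(w')+\ell(w'')$. In a monoid $M$, $f$ left-divides $g$ if $g=fg'$ for some $g'\in M$, and $f$ right-divides $g$ if $g=g'f$ for some $g'\in M$. A Garside monoid is a pair $(M,\Delta)$ where $M$ is a monoid such that: (1) there is a map $\mu:M\to\mathbb{N}$ with $\mu(fg)\ge\mu(f)+\mu(g)$ and $g\ne1\Rightarrow\mu(g)\neq0$; (2) $M$ is cancellative ($hfk=hgk\Rightarrow f=g$); (3) any two elements of $M$ have a gcd and an lcm for left-divisibility and for right-divisibility; (4) $\Delta\in M$ is a Garside element: its set of left divisors coincides with its set of right divisors and generates $M$. The divisors of $\Delta$ are called the simples (they are not required to be finite in number). The group of fractions is the group in which a cancellative monoid where any two elements have common multiples embeds (Ore). The Garside monoid $(M([1,w]),\underline{w})$ is called an interval Garside monoid when $w$ is balanced and $([1,w],\preceq)$ and $([1,w]_r,\preceq_r)$ are lattices.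
   Formalization: The generator attached to 1 in [1,λ^k] is identified with the unit of M([1,λ^k]); with the listed relations alone it would be an idempotent different from the unit, and the monoid would not be cancellative. *)

(* Defs.v *)
From HB Require Import structures.
From mathcomp Require Import all_boot all_order all_algebra perm.
From mathcomp Require Import boolp classical_sets functions.

Set Implicit Arguments.
Unset Strict Implicit.
Unset Printing Implicit Defensive.

Import GRing.Theory.

Local Open Scope quotient_scope.
Local Open Scope classical_set_scope.
Local Open Scope group_scope.

Section PresentedMonoid.
Variables (A : choiceType) (R : seq A -> seq A -> Prop).

Inductive pres_cong : seq A -> seq A -> Prop :=
| pres_cong_rel u v : R u v -> pres_cong u v
| pres_cong_refl u : pres_cong u u
| pres_cong_sym u v : pres_cong u v -> pres_cong v u
| pres_cong_trans u v w : pres_cong u v -> pres_cong v w -> pres_cong u w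
| pres_cong_cat u u' v v' :
    pres_cong u u' -> pres_cong v v' -> pres_cong (u ++ v) (u' ++ v').

Definition pres_congb (u v : seq A) : bool := `[< pres_cong u v >].

Lemma pres_congb_refl : reflexive pres_congb.
Proof. by move=> u; apply/asboolP; apply: pres_cong_refl. Qed.

Lemma pres_congb_sym : symmetric pres_congb.
Proof.
by move=> u v; apply/idP/idP => /asboolP uv; apply/asboolP;
  apply: pres_cong_sym.
Qed.

Lemma pres_congb_trans : transitive pres_congb.
Proof.
move=> v u w /asboolP uv /asboolP vw; apply/asboolP.
exact: pres_cong_trans uv vw.
Qed.

Canonical pres_equiv :=
  EquivRel pres_congb pres_congb_refl pres_congb_sym pres_congb_trans.

Definition presented : Type := {eq_quot pres_equiv}.

HB.instance Definition _ := Choice.on presented.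

Definition pres_class (u : seq A) : presented := \pi_({eq_quot pres_equiv})%qT u.

Definition pres_mul (a b : presented) : presented :=
  pres_class (repr a ++ repr b).

Lemma pres_classP u v : pres_class u = pres_class v <-> pres_cong u v.
Proof.
split; first by move=> /eqmodP /asboolP.
by move=> uv; apply/eqmodP/asboolP.
Qed.

Lemma pres_class_repr (a : presented) : pres_class (repr a) = a.
Proof. exact: reprK. Qed.

Lemma pres_mul_class u v :
  pres_mul (pres_class u) (pres_class v) = pres_class (u ++ v).
Proof.
by apply/pres_classP; apply: pres_cong_cat; apply/pres_classP;
  rewrite pres_class_repr.
Qed.

Lemma pres_mulA : associative pres_mul.
Proof.
move=> a b c; rewrite -(pres_class_repr a) -(pres_class_repr b).
by rewrite -(pres_class_repr c) !pres_mul_class catA.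
Qed.

Lemma pres_mul1 : left_id (pres_class [::]) pres_mul.
Proof.
by move=> a; rewrite -(pres_class_repr a) pres_mul_class.
Qed.

Lemma pres_mulr1 : right_id (pres_class [::]) pres_mul.
Proof.
by move=> a; rewrite -(pres_class_repr a) pres_mul_class cats0.
Qed.

HB.instance Definition _ :=
  isMonoid.Build presented pres_mulA pres_mul1 pres_mulr1.

End PresentedMonoid.

Definition left_divides (M : monoidType) (f g : M) : Prop :=
  exists g', g = f * g'.

Definition right_divides (M : monoidType) (f g : M) : Prop :=
  exists g', g = g' * f.

(* For [P] the whole monoid and [le] a divisibility relation, these are the gcds
   and the lcms. *)
Definition is_inf (T : Type) (P : set T) (le : T -> T -> Prop) (f g d : T) :=
  [/\ P d, le d f, le d g & forall e, P e -> le e f -> le e g -> le e d].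

Definition is_sup (T : Type) (P : set T) (le : T -> T -> Prop) (f g m : T) :=
  [/\ P m, le f m, le g m & forall e, P e -> le f e -> le g e -> le m e].

Definition has_inf_sup (T : Type) (P : set T) (le : T -> T -> Prop) : Prop :=
  forall f g, P f -> P g ->
    (exists d, is_inf P le f g d) /\ (exists m, is_sup P le f g m).

Definition is_lattice (T : Type) (P : set T) (le : T -> T -> Prop) : Prop :=
  [/\ (forall f, P f -> le f f),
      (forall f g, P f -> P g -> le f g -> le g f -> f = g),
      (forall f g h, P f -> P g -> P h -> le f g -> le g h -> le f h)
    & has_inf_sup P le].

Definition left_divisors (M : monoidType) (d : M) : set M :=
  [set f | left_divides f d].

Definition right_divisors (M : monoidType) (d : M) : set M :=
  [set f | right_divides f d].

Definition generates (M : monoidType) (S : set M) : Prop :=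
  forall g : M, exists2 s : seq M,
    (forall h, h \in s -> S h) & g = \prod_(h <- s) h.

Definition garside_monoid (M : monoidType) (Delta : M) : Prop :=
  [/\ (exists2 mu : M -> nat, (forall f g, (mu f + mu g <= mu (f * g)%g)%N)
        & forall g, g <> 1 -> mu g <> 0%N),
      (forall h f g k : M, h * f * k = h * g * k -> f = g),
      has_inf_sup [set: M] (@left_divides M),
      has_inf_sup [set: M] (@right_divides M)
    & left_divisors Delta = right_divisors Delta /\
      generates (left_divisors Delta)].

Definition is_group_of_fractions (M : monoidType) (H : groupType)
    (iota : M -> H) : Prop :=
  [/\ iota 1 = 1 /\ {morph iota : a b / a * b},
      injective iota,
      (forall h, exists a b, h = iota a * (iota b)^-1)
    & (forall h, exists a b, h = (iota a)^-1 * iota b)].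

Section Interval.
Variables (G : groupType) (X : set G).

Definition has_word (g : G) (m : nat) : Prop :=
  exists s : seq G,
    [/\ size s = m, (forall h, h \in s -> X h) & \prod_(h <- s) h = g].

(* Junk value 0 when [g] is not a product of elements of [X]. *)
Definition len (g : G) : nat :=
  xget 0%N [set m | has_word g m /\ forall p, has_word g p -> (m <= p)%N].

Definition preceq (v w : G) : Prop := (len v + len (v^-1 * w)%g = len w)%N.

Definition preceq_r (v w : G) : Prop := (len (w * v^-1)%g + len v = len w)%N.

Definition itv (w : G) : set G := [set v | preceq v w].

Definition itv_r (w : G) : set G := [set v | preceq_r v w].

Definition balanced (w : G) : Prop := itv w = itv_r w.

(* The unit of the group, which lies in every interval, stands for the unit of
   the interval monoid. The relations of the second kind alone only make the
   generator attached to it an idempotent, hence the relation [itv_rel1]. *)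
Inductive itv_rel (w : G) : seq (itv w) -> seq (itv w) -> Prop :=
| itv_rel1 (v : itv w) : val v = 1 -> itv_rel [:: v] [::]
| itv_relM (v v' v'' : itv w) :
    val v = val v' * val v'' -> len (val v) = (len (val v') + len (val v''))%N ->
    itv_rel [:: v] [:: v'; v''].

Definition itv_monoid (w : G) : monoidType := presented (@itv_rel w).

Definition under (w : G) (v : itv w) : itv_monoid w :=
  pres_class (@itv_rel w) [:: v].

Lemma len1 : len 1 = 0%N.
Proof.
rewrite /len; case: xgetP => // m _ [_ /(_ 0%N)]; rewrite leqn0 => mP.
by apply/eqP/mP; exists [::]; split=> //; rewrite big_nil.
Qed.

Lemma itv_refl (w : G) : w \in itv w.
Proof. by rewrite inE /itv /= /preceq mulVg len1 addn0. Qed.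

Definition itv_top (w : G) : itv w := exist _ w (itv_refl w).

Definition interval_garside_monoid (w : G) : Prop :=
  [/\ balanced w,
      is_lattice (itv w) preceq,
      is_lattice (itv_r w) preceq_r
    & garside_monoid (under (itv_top w))].

End Interval.

Definition expgz (G : groupType) (g : G) (k : int) : G :=
  match k with Posz m => g ^+ m | Negz m => g ^- m.+1 end.

Section Ginf.
Variables (L : fieldType) (n : nat) (x : L).
Local Open Scope ring_scope.

Definition monomial_mx (A : 'M[L]_n) : bool :=
  [forall i, #|[set j | A i j != 0]%SET| == 1%N] &&
  [forall j, #|[set i | A i j != 0]%SET| == 1%N].

Definition ginf_pred (A : 'M[L]_n) : bool :=
  `[< [/\ monomial_mx A,
          (forall i j, A i j != 0 -> exists m : int, A i j = x ^ m)
        & \prod_i \prod_(j | A i j != 0) A i j = 1] >].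

Record ginf : Type := Ginf { ginf_mx :> 'M[L]_n; _ : ginf_pred ginf_mx }.

HB.instance Definition _ := [isSub for ginf_mx].
HB.instance Definition _ := [Choice of ginf by <:].

Definition dperm_mx (d : 'I_n -> L) (s : 'S_n) : 'M[L]_n :=
  \matrix_(i, j) (d i *+ (s i == j)).

Lemma ginf_predP (A : 'M[L]_n) :
  ginf_pred A <-> exists d s, [/\ A = dperm_mx d s, forall i, d i != 0,
    forall i, exists m : int, d i = x ^ m & \prod_i d i = 1].
Proof.
split=> [/asboolP[/andP[/forallP rA /forallP cA] eA pA]|].
  have /fin_all_exists[s sP] : forall i, exists j, [set k | A i k != 0]%SET = [set j]%SET.
    by move=> i; apply/cards1P/rA.
  have nz i : A i (s i) != 0 by have /setP/(_ (s i)) := sP i; rewrite !inE eqxx.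
  have z i j : A i j != 0 -> s i = j.
    by move=> Aij; have /setP/(_ j) := sP i; rewrite !inE Aij => /esym/eqP.
  have s_inj : injective s.
    move=> i i' sii'; have /cards1P[k /setP kP] := cA (s i).
    have := kP i; have := kP i'; rewrite !inE nz sii' nz.
    by move=> /esym/eqP-> /esym/eqP->.
  exists (fun i => A i (s i)), (perm s_inj); split=> //.
  - apply/matrixP=> i j; rewrite mxE permE; case: eqP => [->//|sij].
    by apply/eqP/negbNE/negP => /z.
  - by move=> i; apply: eA.
  - rewrite -[RHS]pA; apply: eq_bigr => i _; rewrite (big_pred1 (s i)) // => j /=.
    apply/idP/eqP => [/z->//|->]; exact: nz.
move=> [d [s [-> nz pw pr]]].
have dE i j : (dperm_mx d s i j != 0) = (s i == j).
  by rewrite mxE; case: (s i == j); rewrite ?nz // eqxx.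
apply/asboolP; split.
- apply/andP; split; apply/forallP => i; apply/cards1P.
    by exists (s i); apply/setP=> j; rewrite !inE dE eq_sym.
  exists ((s^-1)%g i); apply/setP=> j; rewrite !inE dE.
  by rewrite -(can2_eq (permK s) (permKV s)).
- by move=> i j; rewrite dE mxE => ->; apply: pw.
- rewrite -[RHS]pr; apply: eq_bigr => i _; rewrite (big_pred1 (s i)) //.
    by rewrite mxE eqxx.
  by move=> j /=; rewrite dE eq_sym.
Qed.

Lemma dperm_mxM d d' s s' :
  dperm_mx d s *m dperm_mx d' s' =
  dperm_mx (fun i => d i * d' (s i)) (s * s')%g.
Proof.
apply/matrixP=> i j; rewrite !mxE (bigD1 (s i)) //= big1 => [|k ki].
  by rewrite !mxE eqxx addr0 permM mulrnAr.
by rewrite !mxE eq_sym (negbTE ki) mul0r.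
Qed.

Lemma ginf_pred1 : ginf_pred 1%:M.
Proof.
apply/ginf_predP; exists (fun=> 1), 1%g; split.
- by apply/matrixP=> i j; rewrite !mxE perm1.
- by move=> _; apply: oner_neq0.
- by move=> _; exists 0.
- by rewrite big1.
Qed.

Lemma ginf_predM A B : ginf_pred A -> ginf_pred B -> ginf_pred (A *m B).
Proof.
move=> /ginf_predP[d [s [-> nz pw pr]]] /ginf_predP[d' [s' [-> nz' pw' pr']]].
apply/ginf_predP; rewrite dperm_mxM.
eexists; eexists; split; first reflexivity.
- by move=> i; rewrite mulf_neq0.
- move=> i /=; have [m dm] := pw i; have [m' dm'] := pw' (s i).
  have [x0|x0] := eqVneq x 0; last by exists (m + m'); rewrite expfzDr // dm dm'.
  exists 0; move: (nz i) (nz' (s i)); rewrite dm dm' x0 !exp0rz eqxx.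
  by case: (m == 0); rewrite ?eqxx //; case: (m' == 0); rewrite ?eqxx ?mulr1.
- rewrite big_split /= pr mul1r -[RHS]pr'.
  by rewrite [RHS](reindex_inj (@perm_inj _ s)).
Qed.

(* [0^-1 = 0], so this is the inverse of a monomial matrix. *)
Definition ginf_inv_mx (A : 'M[L]_n) : 'M[L]_n := \matrix_(i, j) (A j i)^-1.

Lemma dperm_inv_mx d s : ginf_inv_mx (dperm_mx d s) =
  dperm_mx (fun i => (d ((s^-1)%g i))^-1) s^-1%g.
Proof.
apply/matrixP=> i j; rewrite !mxE.
rewrite (can2_eq (permK s) (permKV s)) eq_sym.
by case: eqP => [<-|_] //=; rewrite ?invr0.
Qed.

Lemma ginf_predV A : ginf_pred A -> ginf_pred (ginf_inv_mx A).
Proof.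
move=> /ginf_predP[d [s [-> nz pw pr]]]; apply/ginf_predP.
rewrite dperm_inv_mx; eexists; eexists; split; first reflexivity.
- by move=> i; rewrite invr_neq0.
- by move=> i /=; have [m ->] := pw ((s^-1)%g i); exists (- m); rewrite invr_expz.
- have e : \prod_i d ((s^-1)%g i) = 1.
    by rewrite -[RHS]pr [RHS](reindex_inj (@perm_inj _ s^-1%g)).
  by rewrite prodfV e invr1.
Qed.

Lemma ginf_invl A : ginf_pred A -> ginf_inv_mx A *m A = 1%:M.
Proof.
move=> /ginf_predP[d [s [-> nz _ _]]]; rewrite dperm_inv_mx dperm_mxM.
apply/matrixP=> i j; rewrite !mxE mulVg perm1 mulVf //.
Qed.

Lemma ginf_invr A : ginf_pred A -> A *m ginf_inv_mx A = 1%:M.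
Proof.
move=> /ginf_predP[d [s [-> nz _ _]]]; rewrite dperm_inv_mx dperm_mxM.
apply/matrixP=> i j; rewrite !mxE mulgV perm1 permK divff //.
Qed.

Definition ginf_one : ginf := Ginf ginf_pred1.
Definition ginf_mul (A B : ginf) : ginf := Ginf (ginf_predM (valP A) (valP B)).
Definition ginf_inv (A : ginf) : ginf := Ginf (ginf_predV (valP A)).

Fact ginf_mulA : associative ginf_mul.
Proof. by move=> A B C; apply: val_inj; apply: mulmxA. Qed.
Fact ginf_mul1 : left_id ginf_one ginf_mul.
Proof. by move=> A; apply: val_inj; apply: mul1mx. Qed.
Fact ginf_mulr1 : right_id ginf_one ginf_mul.
Proof. by move=> A; apply: val_inj; apply: mulmx1. Qed.
Fact ginf_mulV : left_inverse ginf_one ginf_inv ginf_mul.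
Proof. by move=> A; apply: val_inj; apply: ginf_invl; apply: valP. Qed.
Fact ginf_mulrV : right_inverse ginf_one ginf_inv ginf_mul.
Proof. by move=> A; apply: val_inj; apply: ginf_invr; apply: valP. Qed.

HB.instance Definition _ := isMonoid.Build ginf ginf_mulA ginf_mul1 ginf_mulr1.
HB.instance Definition _ := hasInv.Build ginf ginf_inv.
HB.instance Definition _ := Monoid_isGroup.Build ginf ginf_mulV ginf_mulrV.

Definition t_mx (i : int) : 'M[L]_n :=
  \matrix_(a, b)
    if (a == 0%N :> nat) && (b == 1%N :> nat) then x ^ (- i)
    else if (a == 1%N :> nat) && (b == 0%N :> nat) then x ^ i
    else ((1 < a)%N && (a == b))%:R.

(* Rows and columns are numbered from 0, so that s_j transposes j-2 and j-1. *)
Definition ginf_gen : set ginf :=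
  [set g | (exists i : int, val g = t_mx i) \/
           (exists a b : 'I_n,
              [/\ (0 < a)%N, b = a.+1 :> nat & val g = tperm_mx a b])].

Definition lambda_mx : 'M[L]_n :=
  diag_mx (\row_j if j == 0%N :> nat then x ^- n.-1 else x).

(* By [val_lambda], the default value is never used for n > 0 and x != 0. *)
Definition lambda : ginf := insubd (1%g : ginf) lambda_mx.

Lemma val_lambda : x != 0 -> (0 < n)%N -> val lambda = lambda_mx.
Proof.
move=> x0 n0; rewrite val_insubd ifT //; apply/ginf_predP.
exists (fun j => if j == 0%N :> nat then x ^- n.-1 else x), 1%g; split.
- by apply/matrixP=> i j; rewrite !mxE perm1.
- by move=> i; case: ifP => // _; rewrite invr_neq0 // expf_neq0.
- move=> i; case: ifP => _; last by exists 1; rewrite expr1z.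
  by exists (- n.-1%:Z); rewrite exprnN.
- rewrite (bigD1 (Ordinal n0)) //= (eq_bigr (fun=> x)) => [|i].
    rewrite prodr_const cardC1 card_ord mulVf // expf_neq0 //.
  by rewrite -val_eqE /= => /negbTE->.
Qed.

End Ginf.

(* Main.v *)
Require Import Defs.
From HB Require Import structures.
From mathcomp Require Import all_boot all_order all_algebra perm zify.
From mathcomp Require Import boolp classical_sets functions.

Set Implicit Arguments.
Unset Strict Implicit.
Unset Printing Implicit Defensive.

Import GRing.Theory.

Local Open Scope classical_set_scope.
Local Open Scope group_scope.

(** An element v of the group has a permutation s and exponents d_i, its nonzero
    entries being x^(d_i) in position (i, s(i)); the exponents are well defined
    because x has infinite order. Sorting the rows shows that the length of v is
    the sum over pairs of rows i < j of 1 if s(i) > s(j), of 0 if s(i) < s(j) and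
    d_j = 0, and of 2 if s(i) < s(j) and d_j <> 0 ([len_coord]). Left
    multiplication by a generator only changes the contribution of one pair of
    adjacent rows, so the generators below v are read off from two rows of v.

    For w a power of lambda, with all exponents equal to k <> 0 below the first
    row, the formula makes v^-1 w and w v^-1 equally long, so w is balanced. Two
    generators below a common v in [1, w] have a supremum that does not depend
    on v ([local_sup]): this is a braid or a commutation relation, except for t_m
    and t_m', where membership in [1, w] forces the value x^k in the second row
    and the supremum is t_m t_(m-k) = t_m' t_(m'-k). Because lengths are bounded,
    a confluence argument promotes these local suprema to infima of arbitrary
    pairs ([inf_of_local_sup]); suprema follow by taking a shortest upper bound,
    and the right order is dual to the left one under v |-> v^-1 w.

    The rest holds for every balanced w for which [1, w] has infima. The largest
    part of c that can be moved into a is the infimum of a^-1 w and c. Iterating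
    this defines the head of an element of the monoid, a simple, and its tail;
    that the construction respects the relations ([absorbM]) shows that [1, w]
    embeds in the monoid and that the latter is left cancellative. Conjugation by
    w extends to an automorphism phi with m Delta = Delta phi(m), which exchanges
    left and right: it yields right cancellation, common multiples, and the
    group of fractions as the set of formal quotients a Delta^-m. Left gcds are
    found by dividing repeatedly by the infimum of the heads, and right gcds by
    complementing left lcms in a power of Delta. *)

(** * Suprema from infima *)

(** An upper bound of minimal rank absorbs every other upper bound, since its
    infimum with that bound is again an upper bound. *)
Lemma has_inf_sup_of_inf (T : Type) (P : set T) (le : T -> T -> Prop)
    (rank : T -> nat) :
  (forall f, P f -> le f f) ->
  (forall f g h, P f -> P g -> P h -> le f g -> le g h -> le f h) ->
  (forall f g, P f -> P g -> le f g -> (rank g <= rank f)%N -> le g f) ->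
  (forall f g, P f -> P g -> exists d, is_inf P le f g d) ->
  (forall f g, P f -> P g -> exists m, [/\ P m, le f m & le g m]) ->
  has_inf_sup P le.
Proof.
move=> lexx letr lerank infs bnds f g Pf Pg; split; first exact: infs.
have [m0 m0P] := bnds f g Pf Pg.
pose Q k := `[< exists m, [/\ P m, le f m, le g m & rank m = k] >].
have exQ : exists k, Q k.
  by exists (rank m0); apply/asboolP; exists m0; case: m0P.
case: (ex_minnP exQ) => k /asboolP[m [Pm fm gm mk]] kmin.
exists m; split=> // e Pe fe ge.
have [d [Pd dm de dmax]] := infs _ _ Pm Pe.
have md : (rank m <= rank d)%N.
  by rewrite mk; apply/kmin/asboolP; exists d; split=> //; apply: dmax.
exact: letr (lerank _ _ Pd Pm dm md) de.
Qed.

(** * Groups of fractions *)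

(** As every element divides a power of [D], the powers of [D] suffice as
    denominators; as [D] commutes with everything up to [phi], two fractions
    a D^-m and b D^-p multiply to a phi^m(b) D^-(m+p). *)
Section Fractions.
Variables (M : monoidType) (D : M) (phi : M -> M).
Hypothesis mulIl : forall h f g : M, h * f = h * g -> f = g.
Hypothesis mulIr : forall h f g : M, f * h = g * h -> f = g.
Hypothesis phiM : {morph phi : a b / a * b}.
Hypothesis phiS : forall a, exists b, phi b = a.
Hypothesis phiD : forall m, m * D = D * phi m.
Hypothesis divD : forall m, exists N c, m * c = D ^+ N.

Lemma iter_phiM N : {morph iter N phi : a b / a * b}.
Proof. by move=> a b; elim: N => //= N ->; rewrite phiM. Qed.

Lemma iter_phiS N a : exists b, iter N phi b = a.
Proof.
elim: N a => [|N IH] a; first by exists a.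
by have [b <-] := phiS a; have [c <-] := IH b; exists c.
Qed.

Lemma phiDX N m : m * D ^+ N = D ^+ N * iter N phi m.
Proof.
elim: N => [|N IH]; first by rewrite mulg1 mul1g.
by rewrite expgSr mulgA IH -mulgA phiD mulgA.
Qed.

Lemma iter_phi_D p N : iter p phi (D ^+ N) = D ^+ N.
Proof. by apply: (@mulIl (D ^+ p)); rewrite -phiDX -!expgnDr addnC. Qed.

Lemma complementC N m c : m * c = D ^+ N -> c * iter N phi m = D ^+ N.
Proof. by move=> mc; apply: (@mulIl m); rewrite mulgA mc phiDX. Qed.

Lemma left_complement N m : (exists c, m * c = D ^+ N) ->
  exists c, c * m = D ^+ N.
Proof.
move=> [c /complementC mc]; have [c' c'c] := iter_phiS N c.
exists c'; apply: (@mulIr (D ^+ N)).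
by rewrite phiDX iter_phiM c'c mc.
Qed.

(** The pair (a, m) stands for the fraction a D^-m. *)
Definition frac_eqb (u v : M * nat) : bool :=
  u.1 * D ^+ v.2 == v.1 * D ^+ u.2.

Lemma frac_eqb_refl : reflexive frac_eqb.
Proof. by move=> u; apply: eqxx. Qed.

Lemma frac_eqb_sym : symmetric frac_eqb.
Proof. by move=> u v; apply: eq_sym. Qed.

Lemma frac_eqb_trans : transitive frac_eqb.
Proof.
move=> [b p] [a m] [c q] /eqP/= ab /eqP/= bc; apply/eqP => /=.
apply: (@mulIr (D ^+ p)).
by rewrite -mulgA -expgnDr addnC expgnDr mulgA ab -mulgA -expgnDr addnC
  expgnDr mulgA bc -!mulgA -!expgnDr addnC.
Qed.

Canonical frac_equiv :=
  EquivRel frac_eqb frac_eqb_refl frac_eqb_sym frac_eqb_trans.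

Definition frac : Type := {eq_quot frac_equiv}%qT.

HB.instance Definition _ := Choice.on frac.

Definition frac_class (u : M * nat) : frac := \pi_({eq_quot frac_equiv})%qT u.

Lemma frac_classP u v :
  frac_class u = frac_class v <-> u.1 * D ^+ v.2 = v.1 * D ^+ u.2.
Proof. by split=> [/eqmodP/eqP//|uv]; apply/eqmodP/eqP. Qed.

Lemma frac_class_repr (a : frac) : frac_class (repr a) = a.
Proof. exact: reprK. Qed.

Definition pair_mul (u v : M * nat) : M * nat :=
  (u.1 * iter u.2 phi v.1, (u.2 + v.2)%N).

Definition frac_mul (a b : frac) : frac :=
  frac_class (pair_mul (repr a) (repr b)).

Lemma frac_mul_class u v :
  frac_mul (frac_class u) (frac_class v) = frac_class (pair_mul u v).
Proof.
rewrite /frac_mul; case: (repr _) (frac_class_repr (frac_class u)) => a' m'.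
move=> /frac_classP /=; case: u => a m /= aa'.
case: (repr _) (frac_class_repr (frac_class v)) => b' p'.
move=> /frac_classP /=; case: v => b p /= bb'.
apply/frac_classP => /=.
(* phi fixes D, so the relation between b and b' survives applying phi^m' *)
have e1 : iter m' phi b' * D ^+ p = iter m' phi b * D ^+ p'.
  by rewrite -(iter_phi_D m' p) -(iter_phi_D m' p') -!iter_phiM bb'.
have e2 : a' * iter m' phi b * D ^+ m = a * iter m phi b * D ^+ m'.
  by rewrite -!mulgA !phiDX -!iterD !mulgA aa' addnC.
rewrite [(m + p)%N]addnC expgnDr -!mulgA (mulgA _ (D ^+ p)) e1.
rewrite -(mulgA _ (D ^+ p')) -expgnDr addnC expgnDr !mulgA e2.
by rewrite -!mulgA -expgnDr.
Qed.

Lemma frac_mulA : associative frac_mul.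
Proof.
move=> a b c; rewrite -(frac_class_repr a) -(frac_class_repr b).
rewrite -(frac_class_repr c) !frac_mul_class /pair_mul /=.
by rewrite iter_phiM -iterD addnA mulgA.
Qed.

Lemma frac_mul1 : left_id (frac_class (1, 0%N)) frac_mul.
Proof.
move=> a; rewrite -(frac_class_repr a) frac_mul_class /pair_mul /= mul1g.
by case: (repr a).
Qed.

Lemma frac_mulr1 : right_id (frac_class (1, 0%N)) frac_mul.
Proof.
move=> a; rewrite -(frac_class_repr a) frac_mul_class /pair_mul /= addn0.
by rewrite (iter_phi_D _ 0) mulg1; case: (repr a).
Qed.

Lemma frac_inverse_ex (a : frac) :
  exists b, frac_mul b a = frac_class (1, 0%N) /\
            frac_mul a b = frac_class (1, 0%N).
Proof.
rewrite -(frac_class_repr a); case: (repr a) => {}a m.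
have [N [c ac]] := divD a.
exists (frac_class (D ^+ m * c, N)); rewrite !frac_mul_class /pair_mul /=.
split; apply/frac_classP => /=; rewrite expg0 mulg1 mul1g.
  by rewrite -mulgA (complementC ac) -expgnDr addnC.
rewrite iter_phiM iter_phi_D mulgA phiDX -mulgA -iter_phiM ac iter_phi_D.
by rewrite -expgnDr.
Qed.

Definition frac_inv (a : frac) : frac := sval (cid (frac_inverse_ex a)).

Lemma frac_mulV : left_inverse (frac_class (1, 0%N)) frac_inv frac_mul.
Proof. by move=> a; case: (svalP (cid (frac_inverse_ex a))). Qed.

Lemma frac_mulrV : right_inverse (frac_class (1, 0%N)) frac_inv frac_mul.
Proof. by move=> a; case: (svalP (cid (frac_inverse_ex a))). Qed.

HB.instance Definition _ :=
  isMonoid.Build frac frac_mulA frac_mul1 frac_mulr1.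
HB.instance Definition _ := hasInv.Build frac frac_inv.
HB.instance Definition _ := Monoid_isGroup.Build frac frac_mulV frac_mulrV.

Lemma group_of_fractions_ex :
  exists (H : groupType) (iota : M -> H), is_group_of_fractions iota.
Proof.
exists frac, (fun a => frac_class (a, 0%N)).
have mulE u v : frac_class u * frac_class v = frac_class (pair_mul u v).
  exact: frac_mul_class.
split.
- by split=> [//|a b]; rewrite mulE.
- by move=> a b /frac_classP /=; rewrite expg0 !mulg1.
- move=> h; rewrite -(frac_class_repr h); case: (repr h) => a m.
  exists a, (D ^+ m); apply: (@mulIg _ (frac_class (D ^+ m, 0%N))).
  rewrite mulgVK mulE /pair_mul /= iter_phi_D addn0.
  by apply/frac_classP; rewrite /= expg0 mulg1.
- move=> h; rewrite -(frac_class_repr h); case: (repr h) => a m.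
  have [b ba] := iter_phiS m a.
  exists (D ^+ m), b; apply: (@mulgI _ (frac_class (D ^+ m, 0%N))).
  rewrite mulVKg mulE /pair_mul /= add0n.
  by apply/frac_classP; rewrite /= expg0 mulg1 -ba -phiDX.
Qed.

End Fractions.
(** * Word length *)

(* Rewriting with group identities can leave the same length at two convertible
   but distinct terms, which [set] identifies and [lia] does not. *)
Ltac len_lia :=
  repeat match goal with H : context [len _ _] |- _ => revert H end;
  repeat (let u := fresh "u" in set u := (len _ _); clearbody u); lia.

Section WordLength.
Variables (G : groupType) (X : set G).
Hypothesis Xgen : forall g, exists m, has_word X g m.

Local Notation l := (len X).
Local Notation le := (preceq X).

Lemma len_spec g :
  has_word X g (l g) /\ forall p, has_word X g p -> (l g <= p)%N.
Proof.
pose Q m := `[< has_word X g m >].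
have exQ : exists m, Q m by have [m gm] := Xgen g; exists m; apply/asboolP.
apply: (@xgetPex _ 0%N
  [set m | has_word X g m /\ forall p, has_word X g p -> (m <= p)%N]).
case: (ex_minnP exQ) => m /asboolP gm mmin.
by exists m; split=> // p gp; apply/mmin/asboolP.
Qed.

Lemma has_word_cons x g m : X x -> has_word X g m -> has_word X (x * g) m.+1.
Proof.
move=> Xx [s [<- sX <-]]; exists (x :: s); split=> //; last by rewrite big_cons.
by move=> h; rewrite inE => /predU1P[->//|/sX].
Qed.

Lemma len_mul g h : (l (g * h) <= l g + l h)%N.
Proof.
have [[s [<- sX <-]] _] := len_spec g; have [[t [<- tX <-]] _] := len_spec h.
have [_] := len_spec (\prod_(h0 <- s) h0 * \prod_(h1 <- t) h1).
apply; exists (s ++ t); split; rewrite ?size_cat ?big_cat //.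
by move=> y; rewrite mem_cat => /orP[/sX|/tX].
Qed.

Lemma len_eq0 g : l g = 0%N -> g = 1.
Proof.
move=> g0; have [[s [+ _ <-]] _] := len_spec g.
by rewrite g0 => /size0nil->; rewrite big_nil.
Qed.

Lemma len_gen x : X x -> (l x <= 1)%N.
Proof.
move=> Xx; have [_] := len_spec x; apply; rewrite -[x]mulg1.
by apply: has_word_cons => //; exists [::]; rewrite big_nil.
Qed.

Lemma len_inv g : (forall x, X x -> X x^-1) -> l g^-1 = l g.
Proof.
move=> XV; apply/eqP; rewrite eqn_leq.
suff le_inv h : (l h^-1 <= l h)%N by rewrite le_inv -{1}[g]invgK le_inv.
have [[s [<- sX <-]] _] := len_spec h.
have [_] := len_spec (\prod_(y <- s) y)^-1.
apply; elim: s sX => [|x s IH] sX; first by exists [::]; rewrite !big_nil invg1.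
have [t [ts tX tE]] : has_word X (\prod_(y <- s) y)^-1 (size s).
  by apply: IH => y ys; apply: sX; rewrite inE ys orbT.
exists (rcons t x^-1); split; first by rewrite size_rcons ts.
  move=> y; rewrite mem_rcons inE => /predU1P[->|/tX//].
  by apply/XV/sX; rewrite inE eqxx.
by rewrite big_rcons big_cons invgM tE.
Qed.

Lemma preceq_refl g : le g g.
Proof. by rewrite /preceq mulVg len1 addn0. Qed.

Lemma preceq1 g : le 1 g.
Proof. by rewrite /preceq invg1 mul1g len1. Qed.

Lemma preceq_trans a b c : le a b -> le b c -> le a c.
Proof.
rewrite /preceq => ab bc.
have := len_mul (a^-1 * b) (b^-1 * c); have := len_mul a (a^-1 * c).
by rewrite -mulgA mulVKg mulVKg; len_lia.
Qed.

Lemma preceq_len a b : le a b -> (l a <= l b)%N.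
Proof. by rewrite /preceq => <-; apply: leq_addr. Qed.

Lemma preceq_eq a b : le a b -> (l b <= l a)%N -> a = b.
Proof.
rewrite /preceq => ab ba.
have e : a^-1 * b = 1 by apply: len_eq0; len_lia.
by rewrite -(mulVKg a b) e mulg1.
Qed.

Lemma preceq_anti a b : le a b -> le b a -> a = b.
Proof. by move=> ab /preceq_len; apply: preceq_eq. Qed.

Lemma preceq_mulr a c : le a (a * c) <-> l (a * c) = (l a + l c)%N.
Proof. by rewrite /preceq mulKg; split. Qed.

Lemma preceq_mul2l a b c :
  l (a * b) = (l a + l b)%N -> l (a * c) = (l a + l c)%N ->
  le (a * b) (a * c) <-> le b c.
Proof.
by rewrite /preceq invgM -mulgA mulKg => -> ->; split=> ? *; len_lia.
Qed.

Lemma preceq_add a b c :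
  l (a * c) = (l a + l c)%N -> le b c -> l (a * b) = (l a + l b)%N.
Proof.
rewrite /preceq => ac bc; have := len_mul (a * b) (b^-1 * c).
by have := len_mul a b; rewrite -mulgA mulVKg; len_lia.
Qed.

Lemma preceq_gen g : g <> 1 -> exists x, [/\ X x, l x = 1%N & le x g].
Proof.
have [[[|x s] [ss sX gE]] _] := len_spec g; first by rewrite -gE big_nil.
move=> _; move: ss; rewrite -gE big_cons => ss; exists x.
have Xx : X x by apply: sX; rewrite inE eqxx.
have [_ /(_ (size s)) sl] := len_spec (\prod_(h <- s) h).
have {}sl : (l (\prod_(h <- s) h) <= size s)%N.
  by apply: sl; exists s; split=> // h hs; apply: sX; rewrite inE hs orbT.
move: ss => /= ss; have x1 := len_gen Xx.
have xs := len_mul x (\prod_(h <- s) h).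
by split=> //; [|apply/preceq_mulr]; len_lia.
Qed.

End WordLength.

(** * Interval monoids *)

Section Interval.
Variables (G : groupType) (X : set G) (w : G).
Hypothesis Xgen : forall g, exists m, has_word X g m.
Hypothesis bal : balanced X w.

Local Notation l := (len X).
Local Notation le := (preceq X).
Local Notation P := (itv X w).

Lemma itv_preceq_r v : P v <-> preceq_r X v w.
Proof. by rewrite [itv X w]bal. Qed.

Lemma itv_le a b : le a b -> P b -> P a.
Proof. exact: (preceq_trans Xgen). Qed.

Definition composable (a b : G) := P (a * b) /\ l (a * b) = (l a + l b)%N.

Lemma composable_l a b : composable a b -> P a.
Proof. by move=> [Pab ab]; apply: itv_le Pab; apply/preceq_mulr. Qed.

(** A right factor of an element of the interval is below it for the right order,
    and balance turns this into membership in the interval. *)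
Lemma composable_r a b : composable a b -> P b.
Proof.
move=> [/itv_preceq_r Pab ab]; apply/itv_preceq_r; move: Pab.
rewrite /preceq_r invgM => Pab.
have := len_mul Xgen (w * (b^-1 * a^-1)) a.
have := len_mul Xgen (w * b^-1) b.
by rewrite -!mulgA mulVg mulVg !mulg1; len_lia.
Qed.

Lemma composable_mulA a b c :
  composable (a * b) c -> l (a * b) = (l a + l b)%N ->
  composable a (b * c) /\ composable b c.
Proof.
move=> [Pabc abc] ab; have := len_mul Xgen a (b * c).
have := len_mul Xgen b c; rewrite mulgA => bc abc'.
have c1 : composable a (b * c) by split; rewrite mulgA //; len_lia.
by split=> //; split; [apply: composable_r c1 | len_lia].
Qed.

Lemma composable_mulAr a b c :
  composable a (b * c) -> l (b * c) = (l b + l c)%N ->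
  composable (a * b) c /\ composable a b.
Proof.
move=> [Pabc abc] bc; have := len_mul Xgen (a * b) c.
have := len_mul Xgen a b; move: Pabc abc; rewrite mulgA => Pabc abc ab abc'.
have c1 : composable (a * b) c by split=> //; len_lia.
by split=> //; split; [apply: composable_l c1 | len_lia].
Qed.

Lemma composable_le a b : le a b -> P b -> composable a (a^-1 * b).
Proof. by move=> ab Pb; split; rewrite mulVKg. Qed.

Definition cpl (a : G) : G := a^-1 * w.

Lemma itv_top_in : P w. Proof. exact: preceq_refl. Qed.

Lemma itv1 : P 1. Proof. exact: preceq1. Qed.

Lemma composable_cpl a : P a -> composable a (cpl a).
Proof. by move=> Pa; apply: composable_le => //; apply: itv_top_in. Qed.

Lemma itv_cpl a : P a -> P (cpl a).
Proof. by move=> /composable_cpl/composable_r. Qed.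

(** Composability with [a] is a condition bounded by one element, the
    complement of [a]; this is what makes greedy normal forms available from
    the infima of the interval. *)
Lemma composable_le_cpl a c : P a -> composable a c <-> le c (cpl a).
Proof.
rewrite /composable /itv /= /preceq /cpl invgM -!mulgA => Pa.
split; first by len_lia.
have := len_mul Xgen a c; have := len_mul Xgen (a * c) (c^-1 * (a^-1 * w)).
by rewrite -mulgA !mulVKg; len_lia.
Qed.

Lemma cpl_cpl a : cpl (cpl a) = w^-1 * a * w.
Proof. by rewrite /cpl invgM invgK. Qed.

Lemma len_cpl a : P a -> (l a + l (cpl a))%N = l w.
Proof. by []. Qed.

Lemma itv_conj a : P a -> P (w^-1 * a * w) /\ l (w^-1 * a * w) = l a.
Proof.
move=> Pa; rewrite -cpl_cpl; split; first exact/itv_cpl/itv_cpl.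
by have := len_cpl Pa; have := len_cpl (itv_cpl Pa); len_lia.
Qed.

Lemma itv_conjV a : P a -> P (w * a * w^-1) /\ l (w * a * w^-1) = l a.
Proof.
have wd b : P b -> P (w * b^-1) /\ (l (w * b^-1) + l b)%N = l w.
  move=> Pb; have /itv_preceq_r Pb' := Pb; split=> //.
  by apply: (@composable_l _ b); split; rewrite mulgVK //; apply: itv_top_in.
move=> /wd[/wd[]]; rewrite invgM invgK mulgA => Pwa e1 e2; split=> //; len_lia.
Qed.

(** The common lower bounds of two elements are closed under going down, and
    under local suprema of generators going up. Lengths being bounded, this
    confluence makes the maximal ones unique, as in Newman's lemma. *)
Lemma inf_of_local_sup :
  (forall x y, X x -> X y -> exists z, forall v, P v -> le x v -> le y v ->
     [/\ le x z, le y z & le z v]) ->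
  forall a b, P a -> P b -> exists d, is_inf P le a b d.
Proof.
move=> local a b Pa Pb; pose C c := le c a /\ le c b.
have shift c x e : l (c * x) = (l c + l x)%N -> le c e ->
    le (c * x) e <-> le x (c^-1 * e).
  move=> cx ce; rewrite -{1}(mulVKg c e); apply: preceq_mul2l => //.
  by rewrite mulVKg -ce.
have up c x e : le c e -> le x (c^-1 * e) -> l (c * x) = (l c + l x)%N.
  by move=> ce; apply: (preceq_add Xgen); rewrite mulVKg -ce.
have down c e : le c e -> C e -> C c.
  by move=> ce [ea eb]; split; apply: (preceq_trans Xgen) ce _.
pose succ c x := [/\ X x, l x = 1%N, l (c * x) = (l c + l x)%N & C (c * x)].
have grow c e : C e -> le c e -> e <> c -> exists2 x, succ c x & le (c * x) e.
  move=> Ce ce ne; have [|x [Xx x1 xe]] := preceq_gen Xgen (g := c^-1 * e).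
    by move=> ce1; case: ne; rewrite -(mulVKg c e) ce1 mulg1.
  have cx := up _ _ _ ce xe; have cxe : le (c * x) e by apply/shift.
  by exists x => //; split=> //; apply: down cxe Ce.
suff /(_ (l a).+1 1) : forall N c, C c -> (l a - l c < N)%N ->
    exists m, [/\ C m, le c m & forall e, C e -> le c e -> le e m].
  case=> [||d [[da db] _ dmax]]; first by split; apply: preceq1.
    by rewrite ltnS leq_subr.
  exists d; split=> //; first exact: itv_le da Pa.
  by move=> e _ ea eb; apply: dmax => //; apply: preceq1.
elim=> // N IH c Cc cN.
have [[x cx]|last] := pselect (exists x, succ c x); last first.
  exists c; split=> //; first exact: preceq_refl.
  move=> e Ce ce; have [->|/(grow _ _ Ce ce)[x cx _]] := pselect (e = c).
    exact: preceq_refl.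
  by case: last; exists x.
have above y : succ c y ->
    exists m, [/\ C m, le (c * y) m & forall e, C e -> le (c * y) e -> le e m].
  move=> [_ y1 cy Ccy]; apply: IH => //.
  by have := preceq_len Ccy.1; rewrite cy y1; lia.
have [m [Cm cxm mmax]] := above x cx.
have [Xx _ cxE Ccx] := cx.
have cm : le c m by apply: preceq_trans cxm => //; apply/preceq_mulr.
exists m; split=> // e Ce ce.
have [->//|/(grow _ _ Ce ce)[y cy cye]] := pselect (e = c).
have [m' [Cm' cym' mmax']] := above y cy; have [Xy _ cyE Ccy] := cy.
have [z zP] := local x y Xx Xy.
have bound v : P v -> le c v -> le (c * x) v -> le (c * y) v ->
    [/\ le (c * z) v, le (c * x) (c * z) & le (c * y) (c * z)].
  move=> Pv cv cxv cyv; have cvE := composable_le cv Pv.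
  have [|||xz yz zv] := zP (c^-1 * v); [exact: composable_r cvE|exact/shift..|].
  have czE := up _ _ _ cv zv.
  by split; [apply/shift|apply/preceq_mul2l..].
have [cza cxz cyz] := bound a Pa Cc.1 Ccx.1 Ccy.1.
have [czb _ _] := bound b Pb Cc.2 Ccx.2 Ccy.2.
have czm : le (c * z) m by apply: mmax.
apply: (preceq_trans Xgen (mmax' _ Ce cye)); apply: mmax => //.
apply: (preceq_trans Xgen cxz); apply: mmax' => //.
Qed.

(** ** The right order from the left one *)

Lemma preceq_cpl a b : P a -> P b -> le a b <-> preceq_r X (cpl b) (cpl a).
Proof.
move=> /len_cpl Pa /len_cpl Pb; rewrite /preceq_r {3}/cpl.
rewrite /preceq /cpl invgM invgK mulgA mulgK in Pa Pb *.
by split=> ? *; len_lia.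
Qed.

Lemma cpl_surj a : P a -> exists2 b, P b & a = cpl b.
Proof.
move=> Pa; exists (w * a^-1); last by rewrite /cpl invgM invgK mulgVK.
have /itv_preceq_r Pa' := Pa.
by apply: (@composable_l _ a); split; rewrite mulgVK //; apply: itv_top_in.
Qed.

Hypothesis infs : forall a b, P a -> P b -> exists d, is_inf P le a b d.

Lemma itv_has_inf_sup : has_inf_sup P le.
Proof.
apply: (@has_inf_sup_of_inf _ _ _ l) => //.
- by move=> f _; apply: preceq_refl.
- by move=> f g h _ _ _; apply: preceq_trans.
- by move=> f g _ _ fg gf; rewrite (preceq_eq Xgen fg gf); apply: preceq_refl.
- by move=> f g Pf Pg; exists w; split=> //; apply: itv_top_in.
Qed.

Lemma itv_lattice : is_lattice P le.
Proof.
split; last exact: itv_has_inf_sup.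
- by move=> f _; apply: preceq_refl.
- by move=> f g _ _; apply: preceq_anti.
- by move=> f g h _ _ _; apply: preceq_trans.
Qed.

(** Complementation reverses the left order into the right one. *)
Lemma itv_r_lattice : is_lattice (itv_r X w) (preceq_r X).
Proof.
rewrite -bal.
have cplP f : P f -> exists2 b, P b & f = cpl b by apply: cpl_surj.
split.
- by move=> f _; rewrite /preceq_r mulgV len1.
- move=> f g /cplP[a Pa ->] /cplP[b Pb ->] /preceq_cpl-/(_ Pb Pa) ba.
  by move=> /preceq_cpl-/(_ Pa Pb) ab; rewrite (preceq_anti Xgen ab ba).
- move=> f g h /cplP[a Pa ->] /cplP[b Pb ->] /cplP[c Pc ->].
  move=> /preceq_cpl-/(_ Pb Pa) ba /preceq_cpl-/(_ Pc Pb) cb.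
  by apply/preceq_cpl => //; apply: preceq_trans cb ba.
- move=> f g /cplP[a Pa ->] /cplP[b Pb ->].
  have [[d [Pd da db dmax]] [m [Pm am bm mmin]]] := itv_has_inf_sup Pa Pb.
  split; [exists (cpl m)|exists (cpl d)]; split; rewrite -?preceq_cpl //;
    try exact: itv_cpl.
  + move=> e /cplP[c Pc ->]; rewrite -!preceq_cpl // => ac bc; exact: mmin.
  + move=> e /cplP[c Pc ->]; rewrite -!preceq_cpl // => ca cb; exact: dmax.
Qed.

(** ** Evaluating words *)

Local Notation M := (itv_monoid X w).

(** Totalising the generators as a function on the group lets the relations be
    used without carrying membership proofs inside terms. *)
Definition simple (g : G) : M :=
  if pselect (P g) is left Pg then under (exist _ g (mem_set Pg)) else 1.

Lemma itv_val (v : itv X w) : P (val v).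
Proof. exact: set_mem (valP v). Qed.

Lemma simple_val (v : itv X w) : simple (val v) = under v.
Proof.
rewrite /simple; case: pselect => [Pv|/(_ (itv_val v))//].
by congr under; apply: val_inj.
Qed.

Lemma itv_elt g : P g -> {v : itv X w | val v = g}.
Proof. by move=> Pg; exists (exist _ g (mem_set Pg)). Qed.

Lemma class_cat (u v : seq (itv X w)) :
  pres_class (@itv_rel G X w) u * pres_class (@itv_rel G X w) v =
  pres_class (@itv_rel G X w) (u ++ v).
Proof. exact: pres_mul_class. Qed.

Lemma simple1 : simple 1 = 1.
Proof.
have [v v1] := itv_elt itv1; rewrite -v1 simple_val.
by apply/pres_classP/pres_cong_rel/itv_rel1.
Qed.

Lemma simpleM a b : composable a b -> simple (a * b) = simple a * simple b.
Proof.
move=> ab; have [u uE] := itv_elt ab.1.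
have [v vE] := itv_elt (composable_l ab).
have [v' v'E] := itv_elt (composable_r ab).
rewrite -uE -vE -v'E !simple_val class_cat.
apply/pres_classP/pres_cong_rel/itv_relM; rewrite uE vE v'E //; exact: ab.2.
Qed.

Lemma simple_le a b : le a b -> P b -> simple b = simple a * simple (a^-1 * b).
Proof. by move=> ab Pb; rewrite -simpleM ?mulVKg //; apply: composable_le. Qed.

Lemma under_cons (v : itv X w) u :
  pres_class (@itv_rel G X w) (v :: u) = under v * pres_class _ u.
Proof. by rewrite class_cat. Qed.

Lemma itv_monoid_ind (Q : M -> Prop) :
  Q 1 -> (forall a m, P a -> Q m -> Q (simple a * m)) -> forall m, Q m.
Proof.
move=> Q1 QM m; rewrite -(pres_class_repr m).
elim: (repr m) => [|v u IH]; first exact: Q1.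
by rewrite under_cons -simple_val; apply: QM => //; apply: itv_val.
Qed.

Section Lift.
Variables (T : Type) (idx : T) (op : Monoid.law idx) (h : G -> T).
Hypothesis h1 : h 1 = idx.
Hypothesis hM : forall a b, composable a b -> h (a * b) = op (h a) (h b).

Definition lift (m : M) : T := \big[op/idx]_(v <- repr m) h (val v).

Lemma lift_class u : lift (pres_class _ u) = \big[op/idx]_(v <- u) h (val v).
Proof.
have inv u' v' : pres_cong (@itv_rel G X w) u' v' ->
    \big[op/idx]_(v <- u') h (val v) = \big[op/idx]_(v <- v') h (val v).
  elim=> {u' v'} [_ _ [v v1|v v' v'' vE vl]| | | |] //.
  - by rewrite big_seq1 big_nil v1.
  - rewrite big_seq1 big_cons big_seq1 vE; apply: hM.
    by split; rewrite -vE //; apply: itv_val.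
  - by move=> u1 u2 u3 _ -> _ ->.
  - by move=> u1 u2 u3 u4 _ IH _ IH'; rewrite !big_cat IH IH'.
by apply/inv/pres_classP; rewrite pres_class_repr.
Qed.

Lemma lift_simple a : P a -> lift (simple a) = h a.
Proof.
by move=> /itv_elt[v <-]; rewrite simple_val lift_class big_seq1.
Qed.

Lemma lift1 : lift 1 = idx.
Proof. by rewrite lift_class big_nil. Qed.

Lemma liftM m m' : lift (m * m') = op (lift m) (lift m').
Proof.
by rewrite -(pres_class_repr m) -(pres_class_repr m') class_cat
  !lift_class big_cat.
Qed.
End Lift.

Definition mu : M -> nat := lift addn l.
Definition eval : M -> G := lift *%g id.

Lemma mu_simple a : P a -> mu (simple a) = l a.
Proof. by apply: lift_simple; [apply: len1 | move=> ? ? []]. Qed.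
Lemma muM m m' : mu (m * m') = (mu m + mu m')%N.
Proof. by apply: liftM; [apply: len1 | move=> ? ? []]. Qed.

Lemma eval_simple a : P a -> eval (simple a) = a.
Proof. exact: lift_simple. Qed.
Lemma eval1 : eval 1 = 1.
Proof. exact: lift1. Qed.
Lemma evalM m m' : eval (m * m') = eval m * eval m'.
Proof. exact: liftM. Qed.

Lemma mu_eq0 m : mu m = 0%N -> m = 1.
Proof.
elim/itv_monoid_ind: m => // a m Pa IH; rewrite muM mu_simple // => am.
rewrite IH ?mulg1; last by lia.
by rewrite (len_eq0 Xgen (g := a)) ?simple1 //; lia.
Qed.

Lemma len_eval m : (l (eval m) <= mu m)%N.
Proof.
elim/itv_monoid_ind: m => [|a m Pa IH]; first by rewrite eval1 len1.
rewrite evalM muM eval_simple // mu_simple //.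
by apply: leq_trans (len_mul Xgen _ _) _; rewrite leq_add2l.
Qed.

(** By the triangle inequality the lengths of all final products add up as well;
    these products then lie in the interval, so each step is a relation. *)
Lemma eval_geodesic m : P (eval m) -> (mu m <= l (eval m))%N ->
  m = simple (eval m).
Proof.
elim/itv_monoid_ind: m => [|a m Pa IH]; first by rewrite eval1 simple1.
rewrite evalM muM eval_simple // mu_simple // => Pam am.
have := len_eval m; have := len_mul Xgen a (eval m) => am' mm.
have ac : composable a (eval m) by split=> //; lia.
rewrite simpleM //; congr (_ * _); apply: IH; first exact: composable_r ac.
by lia.
Qed.

Local Notation Delta := (under (itv_top X w)).

Lemma DeltaE : Delta = simple w.
Proof. by rewrite -simple_val. Qed.

Lemma simple_cpl a : P a -> simple a * simple (cpl a) = Delta.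
Proof.
move=> Pa; rewrite -simpleM; last exact: composable_cpl.
by rewrite /cpl mulVKg DeltaE.
Qed.

Lemma Delta_factor f g : f * g = Delta ->
  exists a b, [/\ composable a b, f = simple a & g = simple b].
Proof.
move=> fg; have fgl : (mu f + mu g)%N = l w.
  by rewrite -muM fg DeltaE mu_simple //; apply: itv_top_in.
have fge : eval f * eval g = w.
  by rewrite -evalM fg DeltaE eval_simple //; apply: itv_top_in.
have := len_eval f; have := len_eval g; have := len_mul Xgen (eval f) (eval g).
rewrite fge => h1 h2 h3.
have c : composable (eval f) (eval g).
  by split; rewrite fge; [apply: itv_top_in | lia].
exists (eval f), (eval g); split=> //; apply: eval_geodesic.
- exact: composable_l c.
- by lia.
- exact: composable_r c.
- by lia.
Qed.

Lemma left_divisors_Delta m :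
  left_divisors Delta m <-> exists2 a, P a & m = simple a.
Proof.
split=> [[g /esym/Delta_factor[a [b [/composable_l Pa -> _]]]]|[a Pa ->]].
  by exists a.
by exists (simple (cpl a)); rewrite simple_cpl.
Qed.

Lemma right_divisors_Delta m :
  right_divisors Delta m <-> exists2 a, P a & m = simple a.
Proof.
split=> [[g /esym/Delta_factor[a [b [/composable_r Pb _ ->]]]]|[a Pa ->]].
  by exists b.
by have [b Pb ->] := cpl_surj Pa; exists (simple b); rewrite simple_cpl.
Qed.

(** ** Heads of elements *)

Definition meet (a b : G) : G := xget 1 [set d | is_inf P le a b d].

Lemma meetP a b : P a -> P b -> is_inf P le a b (meet a b).
Proof.
move=> Pa Pb; apply: (@xgetPex _ 1 [set d | is_inf P le a b d]).
exact: infs.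
Qed.

(** The largest left factor of [c] that can be moved into [a]. *)
Definition absorb (a c : G) : G := meet (cpl a) c.

Lemma absorbP a c : P a -> P c ->
  [/\ composable a (absorb a c), le (absorb a c) c
    & forall e, composable a e -> le e c -> le e (absorb a c)].
Proof.
move=> Pa Pc; have [Pd dc dl dmax] := meetP (itv_cpl Pa) Pc.
split=> // [|e ae ec]; first exact/composable_le_cpl.
by apply: dmax => //; [apply: composable_r ae | apply/composable_le_cpl].
Qed.

(** Moving parts of [c] into [a * b] at once, or into [b] and from there into
    [a], gives the same result: a part of [c] that fits into [a * b] fits into
    [b] first. *)
Lemma absorbM a b c : composable a b -> P c ->
  absorb a (b * absorb b c) = b * absorb (a * b) c /\
  le (absorb (a * b) c) (absorb b c).
Proof.
move=> ab Pc.
have [[be ec emax] [abd dc dmax]] :=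
  (absorbP (composable_r ab) Pc, absorbP ab.1 Pc).
set e := absorb b c in be ec emax *; set d := absorb (a * b) c in abd dc dmax *.
have [a_bd bd] := composable_mulA abd ab.2.
have de : le d e by apply: emax.
split=> //; have [af fbe fmax] := absorbP (composable_l ab) be.1.
set f := absorb a _ in af fbe fmax *.
apply: (preceq_anti Xgen); last first.
  by apply: fmax => //; apply/(preceq_mul2l bd.2 be.2).
have bf : le b f by apply: fmax => //; apply/preceq_mulr; apply: be.2.
have Pf : P f by apply: composable_r af.
have bf' := composable_le bf Pf; set g := b^-1 * f in bf'.
have fE : f = b * g by rewrite mulVKg.
rewrite fE in af fbe *; have [abg _] := composable_mulAr af bf'.2.
apply/(preceq_mul2l bf'.2 bd.2)/dmax => //.
by apply: (preceq_trans Xgen) ec; apply/(preceq_mul2l bf'.2 be.2).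
Qed.

(** Multiplying an element with head [c] and tail [m] by the simple [a]: the
    part of [c] that fits moves into [a], the rest of [c] goes to the tail. *)
Definition head_step (a : G) (s : G * M) : G * M :=
  (a * absorb a s.1, simple ((absorb a s.1)^-1 * s.1) * s.2).

Lemma head_step_in a s : P a -> P s.1 -> P (head_step a s).1.
Proof. by move=> Pa Ps; case: (absorbP Pa Ps) => [[]]. Qed.

Lemma head_step1 s : P s.1 -> head_step 1 s = s.
Proof.
move=> Ps; have [_ _ dmax] := absorbP itv1 Ps; have [_ dc _] := absorbP itv1 Ps.
have e : absorb 1 s.1 = s.1.
  apply: (preceq_anti Xgen dc); apply: dmax; last exact: preceq_refl.
  by split; rewrite mul1g ?len1.
by rewrite /head_step e mul1g mulVg simple1 mul1g; case: s {Ps dmax dc e}.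
Qed.

Lemma head_stepM a b s : composable a b -> P s.1 ->
  head_step (a * b) s = head_step a (head_step b s).
Proof.
move=> ab Ps; have [de1 de2] := absorbM ab Ps.
have [bc ec _] := absorbP (composable_r ab) Ps.
rewrite /head_step /= de1 mulgA; congr pair; rewrite mulgA; congr (_ * _).
set d := absorb (a * b) _ in de1 de2 *; set e := absorb b _ in de1 de2 bc ec *.
have Pe : P e by apply: composable_r bc.
have -> : (b * d)^-1 * (b * e) = d^-1 * e by rewrite invgM -mulgA mulKg.
have c2 : composable (d * (d^-1 * e)) (e^-1 * s.1).
  by rewrite mulVKg; apply: composable_le.
have [_ c3] := composable_mulA c2 (composable_le de2 Pe).2.
by rewrite -simpleM // mulgA mulgK.
Qed.

Definition head_tail_word (u : seq (itv X w)) (s : G * M) : G * M :=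
  foldr (fun v => head_step (val v)) s u.

Lemma head_tail_word_in u s : P s.1 -> P (head_tail_word u s).1.
Proof.
by move=> Ps; elim: u => //= v u; apply: head_step_in; apply: itv_val.
Qed.

(** This is where the relations of the monoid are checked; it makes the head and
    the tail functions of the class of a word. *)
Lemma head_tail_word_cong u v s : pres_cong (@itv_rel G X w) u v -> P s.1 ->
  head_tail_word u s = head_tail_word v s.
Proof.
move=> uv; elim: uv s => {u v} [_ _ [v v1|v v' v'' vE vl]| | | |] //.
- by move=> s Ps /=; rewrite v1 head_step1.
- move=> s Ps /=; rewrite vE head_stepM //.
  by split; rewrite -vE //; apply: itv_val.
- by move=> u v _ IH s Ps; rewrite IH.
- by move=> u1 u2 u3 _ IH _ IH' s Ps; rewrite IH ?IH'.
- move=> u1 u2 u3 u4 _ IH _ IH' s Ps; rewrite /head_tail_word !foldr_cat.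
  by rewrite -!/(head_tail_word _ _) IH' // IH //; apply: head_tail_word_in.
Qed.

Definition head_tail (m : M) : G * M := head_tail_word (repr m) (1, 1).
Definition head m := (head_tail m).1.
Definition tail m := (head_tail m).2.

Lemma head_tail_simple a m : P a ->
  head_tail (simple a * m) = head_step a (head_tail m).
Proof.
move=> /itv_elt[v <-]; rewrite simple_val /head_tail.
rewrite -[RHS]/(head_tail_word (v :: repr m) _); apply: head_tail_word_cong.
  by apply/pres_classP; rewrite under_cons !pres_class_repr.
exact: itv1.
Qed.

Lemma head_tail1 : head_tail 1 = (1, 1).
Proof.
rewrite -[RHS]/(head_tail_word [::] _).
apply: head_tail_word_cong; last exact: itv1.
by apply/pres_classP; rewrite pres_class_repr.
Qed.

Lemma head_in m : P (head m).
Proof. by apply: head_tail_word_in; apply: itv1. Qed.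

Lemma head_tailK m : simple (head m) * tail m = m.
Proof.
elim/itv_monoid_ind: m => [|a m Pa IH].
  by rewrite /head /tail head_tail1 simple1 mulg1.
rewrite /head /tail head_tail_simple //= -/(head m) -/(tail m).
have [ad dc _] := absorbP Pa (head_in m).
rewrite simpleM // -mulgA (mulgA _ _ (tail m)) -simpleM.
  by rewrite mulVKg IH.
exact: composable_le (head_in m).
Qed.

Lemma head_simple a : P a -> head (simple a) = a.
Proof.
move=> Pa; rewrite -[simple a]mulg1 /head head_tail_simple // head_tail1 /=.
have [_ dc _] := absorbP Pa itv1.
have -> : absorb a 1 = 1 by apply: (preceq_anti Xgen dc); apply: preceq1.
by rewrite mulg1.
Qed.

Lemma simple_inj a b : P a -> P b -> simple a = simple b -> a = b.
Proof. by move=> Pa Pb ab; rewrite -(head_simple Pa) ab head_simple. Qed.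

Lemma simple_le_head a m : P a ->
  (exists m', m = simple a * m') <-> le a (head m).
Proof.
move=> Pa; split=> [[m' ->]|am].
  rewrite /head head_tail_simple //=; apply/preceq_mulr.
  by case: (absorbP Pa (head_in m')) => [[]].
exists (simple (a^-1 * head m) * tail m).
by rewrite mulgA -simple_le ?head_tailK //; apply: head_in.
Qed.

(** Two elements with the same product by a simple [a] have absorbed the same
    part of their heads into [a], and the two remainders are equal, so putting
    that part back recovers a single element. *)
Lemma itv_mulIl (h f g : M) : h * f = h * g -> f = g.
Proof.
elim/itv_monoid_ind: h f g => [f g|a h Pa IH f g]; first by rewrite !mul1g.
rewrite -!mulgA => /(congr1 head_tail); rewrite !head_tail_simple // => -[].
move: (h * f) (h * g) (IH f g) => {IH} m m' IH /mulgI dd tt; apply: IH.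
have [ad dc _] := absorbP Pa (head_in m).
have [ad' dc' _] := absorbP Pa (head_in m').
rewrite -(head_tailK m) -(head_tailK m') (simple_le dc (head_in m)).
rewrite (simple_le dc' (head_in m')) -!mulgA.
rewrite -/(head m) -/(head m') -/(tail m) -/(tail m') in dd tt *.
by rewrite tt dd.
Qed.

(** ** Conjugation by the Garside element *)

Definition phi : M -> M := lift *%g (fun a => simple (w^-1 * a * w)).
Definition phiV : M -> M := lift *%g (fun a => simple (w * a * w^-1)).

Lemma phi_rel1 : simple (w^-1 * 1 * w) = 1.
Proof. by rewrite mulg1 mulVg simple1. Qed.

Lemma phiV_rel1 : simple (w * 1 * w^-1) = 1.
Proof. by rewrite mulg1 mulgV simple1. Qed.

Lemma phi_relM a b : composable a b ->
  simple (w^-1 * (a * b) * w) = simple (w^-1 * a * w) * simple (w^-1 * b * w).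
Proof.
move=> ab; have e : w^-1 * (a * b) * w = (w^-1 * a * w) * (w^-1 * b * w).
  by rewrite -!mulgA mulVKg.
have [Pab abl] := itv_conj ab.1; have [_ al] := itv_conj (composable_l ab).
have [_ bl] := itv_conj (composable_r ab); have abE := ab.2.
rewrite e; apply: simpleM; rewrite /composable -e; split=> //.
by rewrite abl al bl.
Qed.

Lemma phiV_relM a b : composable a b ->
  simple (w * (a * b) * w^-1) = simple (w * a * w^-1) * simple (w * b * w^-1).
Proof.
move=> ab; have e : w * (a * b) * w^-1 = (w * a * w^-1) * (w * b * w^-1).
  by rewrite -!mulgA mulKg.
have [Pab abl] := itv_conjV ab.1; have [_ al] := itv_conjV (composable_l ab).
have [_ bl] := itv_conjV (composable_r ab); have abE := ab.2.
rewrite e; apply: simpleM; rewrite /composable -e; split=> //.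
by rewrite abl al bl.
Qed.

Lemma phi_simple a : P a -> phi (simple a) = simple (w^-1 * a * w).
Proof. by apply: lift_simple; [apply: phi_rel1 | apply: phi_relM]. Qed.

Lemma phi1 : phi 1 = 1.
Proof. by apply: lift1; [apply: phi_rel1 | apply: phi_relM]. Qed.

Lemma phi_mul : {morph phi : a b / a * b}.
Proof. by move=> a b; apply: liftM; [apply: phi_rel1 | apply: phi_relM]. Qed.

Lemma phiV_simple a : P a -> phiV (simple a) = simple (w * a * w^-1).
Proof. by apply: lift_simple; [apply: phiV_rel1 | apply: phiV_relM]. Qed.

Lemma phiV1 : phiV 1 = 1.
Proof. by apply: lift1; [apply: phiV_rel1 | apply: phiV_relM]. Qed.

Lemma phiV_mul : {morph phiV : a b / a * b}.
Proof. by move=> a b; apply: liftM; [apply: phiV_rel1 | apply: phiV_relM]. Qed.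

Lemma phiK : cancel phi phiV.
Proof.
move=> m; elim/itv_monoid_ind: m => [|a m Pa IH]; first by rewrite phi1 phiV1.
have [Pc _] := itv_conj Pa.
rewrite phi_mul phiV_mul IH phi_simple // phiV_simple //.
by rewrite -!mulgA mulVKg mulgV mulg1.
Qed.

Lemma phiVK : cancel phiV phi.
Proof.
move=> m; elim/itv_monoid_ind: m => [|a m Pa IH]; first by rewrite phiV1 phi1.
have [Pc _] := itv_conjV Pa.
rewrite phiV_mul phi_mul IH phiV_simple // phi_simple //.
by rewrite -!mulgA mulKg mulVg mulg1.
Qed.

Lemma mul_Delta m : m * Delta = Delta * phi m.
Proof.
elim/itv_monoid_ind: m => [|a m Pa IH]; first by rewrite mul1g phi1 mulg1.
rewrite phi_mul phi_simple // -mulgA IH -cpl_cpl.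
rewrite -{1}(simple_cpl (itv_cpl Pa)) mulgA mulgA.
by rewrite (simple_cpl Pa) -!mulgA.
Qed.

(** Left cancellation suffices: multiplying an equality on the right up to a
    Garside element and conjugating turns it into one with that element on the
    left. *)
Lemma itv_mulIr (h f g : M) : f * h = g * h -> f = g.
Proof.
elim/itv_monoid_ind: h f g => [f g|a h Pa IH f g]; first by rewrite !mulg1.
rewrite !mulgA => /IH /(congr1 ( *%g^~ (simple (cpl a)))).
rewrite -!mulgA (simple_cpl Pa) !mul_Delta => /itv_mulIl.
exact: (can_inj phiK).
Qed.

Lemma divides_Delta_pow m : exists N c, m * c = Delta ^+ N.
Proof.
elim/itv_monoid_ind: m => [|a m Pa [N [c mc]]].
  by exists 0%N, 1; rewrite mulg1.
exists N.+1, (c * iter N phi (simple (cpl a))).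
rewrite -mulgA (mulgA m) mc -(phiDX mul_Delta) mulgA (simple_cpl Pa).
by rewrite expgS.
Qed.

Lemma divides_common_Delta_pow m m' :
  exists N, (exists c, m * c = Delta ^+ N) /\ (exists c, m' * c = Delta ^+ N).
Proof.
have [N [c mc]] := divides_Delta_pow m.
have [N' [c' mc']] := divides_Delta_pow m'.
exists (N + N')%N; split.
  by exists (c * Delta ^+ N'); rewrite mulgA mc expgnDr.
by exists (c' * Delta ^+ N); rewrite mulgA mc' addnC expgnDr.
Qed.

Lemma divides_Delta_pow_left N m : (exists c, m * c = Delta ^+ N) ->
  exists c, c * m = Delta ^+ N.
Proof.
apply: (left_complement itv_mulIl itv_mulIr phi_mul _ mul_Delta).
by move=> a; exists (phiV a); apply: phiVK.
Qed.

(** ** Divisibility in the interval monoid *)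

Local Notation ldiv := (@left_divides M).
Local Notation rdiv := (@right_divides M).

Lemma ldiv_trans f g h : ldiv f g -> ldiv g h -> ldiv f h.
Proof. by move=> [a ->] [b ->]; exists (a * b); rewrite mulgA. Qed.

Lemma rdiv_trans f g h : rdiv f g -> rdiv g h -> rdiv f h.
Proof. by move=> [a ->] [b ->]; exists (b * a); rewrite mulgA. Qed.

Lemma ldiv_mul2l h f g : ldiv (h * f) (h * g) <-> ldiv f g.
Proof.
split=> [[c]|[c ->]]; last by exists c; rewrite mulgA.
by rewrite -mulgA => /itv_mulIl ->; exists c.
Qed.

Lemma ldiv_simple_head f : f <> 1 ->
  exists a f', [/\ P a, a <> 1 & f = simple a * f'].
Proof.
elim/itv_monoid_ind: f => // a f Pa IH f1.
have [a1|a1] := pselect (a = 1); last by exists a, f.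
by move: f1; rewrite a1 simple1 mul1g => /IH.
Qed.

(** Division by the infimum [c] of the heads reduces to a smaller pair. A common
    divisor that starts with a simple [a] is reached by induction after
    cancelling [a], which is below [c]. *)
Lemma left_gcd_ex f g : exists d, is_inf [set: M] ldiv f g d.
Proof.
have [N] := ubnP (mu f); elim: N f g => // N IH f g fN.
have [c [Pc cf cg cmax]] := infs (head_in f) (head_in g).
have [f1 fE] := (simple_le_head f Pc).2 cf.
have [g1 gE] := (simple_le_head g Pc).2 cg.
have aP a f' : P a -> ldiv (simple a * f') f -> ldiv (simple a * f') g ->
    le a c.
  move=> Pa [f2 ff] [g2 gg]; apply: cmax => //; apply/simple_le_head => //.
    by exists (f' * f2); rewrite mulgA.
  by exists (f' * g2); rewrite mulgA.
have [c1|c1] := pselect (c = 1).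
  have one_div h : ldiv 1 h by exists h; rewrite mul1g.
  exists 1; split=> //.
  move=> e _ ef eg; have [->//|] := pselect (e = 1).
  move=> /ldiv_simple_head[a [f' [Pa a1 eE]]]; rewrite eE in ef eg.
  have := aP _ _ Pa ef eg; rewrite c1 => ac.
  by case: a1; apply: (preceq_anti Xgen ac); apply: preceq1.
have smaller a m : P a -> a <> 1 -> (mu (simple a * m)%g < N.+1)%N ->
    (mu m < N)%N.
  move=> Pa a1; rewrite muM mu_simple //.
  by have := @len_eq0 _ _ Xgen a; case: (l a) => [/(_ erefl)//|k _]; lia.
rewrite fE in fN; have [d [_ df dg dmax]] := IH f1 g1 (smaller _ _ Pc c1 fN).
exists (simple c * d); split=> //.
- by rewrite fE ldiv_mul2l.
- by rewrite gE ldiv_mul2l.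
move=> e _ ef eg; have [->|] := pselect (e = 1).
  by exists (simple c * d); rewrite mul1g.
move=> /ldiv_simple_head[a [e' [Pa a1 eE]]]; rewrite eE in ef eg *.
have ac := aP _ _ Pa ef eg; have cE := simple_le ac Pc.
rewrite fE cE -mulgA in fN ef; rewrite gE cE -mulgA in eg.
move: ef eg; rewrite cE -!mulgA !ldiv_mul2l => ef eg.
have [h [_ hf hg hmax]] :=
  IH (simple (a^-1 * c) * f1) (simple (a^-1 * c) * g1) (smaller _ _ Pa a1 fN).
apply: ldiv_trans (hmax _ I ef eg) _.
have [h' hE] : ldiv (simple (a^-1 * c)) h.
  by apply: hmax => //; [exists f1 | exists g1].
rewrite hE in hf hg *; move: hf hg; rewrite !ldiv_mul2l => hf hg.
exact: dmax.
Qed.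

Lemma left_has_inf_sup : has_inf_sup [set: M] ldiv.
Proof.
apply: (@has_inf_sup_of_inf _ _ _ mu) => //.
- by move=> f _; exists 1; rewrite mulg1.
- by move=> f g h _ _ _; apply: ldiv_trans.
- move=> f g _ _ [c ->]; rewrite muM => cl.
  by exists 1; rewrite (@mu_eq0 c) ?mulg1 //; lia.
- by move=> f g _ _; apply: left_gcd_ex.
- move=> f g _ _; have [N [[c fc] [c' gc]]] := divides_common_Delta_pow f g.
  by exists (Delta ^+ N); split=> //; [exists c | exists c'].
Qed.

(** Complementation in a power of the Garside element turns left multiples into
    right divisors. *)
Lemma right_gcd_ex f g : exists d, is_inf [set: M] rdiv f g d.
Proof.
have [N [fN gN]] := divides_common_Delta_pow f g.
have [f0 ff0] := divides_Delta_pow_left fN.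
have [g0 gg0] := divides_Delta_pow_left gN.
have [_ [m [_ [f1 mf] [g1 mg] mmin]]] :=
  left_has_inf_sup (I : setT f0) (I : setT g0).
have [h hE] : ldiv m (Delta ^+ N).
  by apply: mmin => //; [exists f | exists g].
exists h; split=> //.
- by exists f1; apply: (@itv_mulIl f0); rewrite ff0 mulgA -mf.
- by exists g1; apply: (@itv_mulIl g0); rewrite gg0 mulgA -mg.
move=> e _ [f2 fE] [g2 gE].
have fg : f0 * f2 = g0 * g2.
  by apply: (@itv_mulIr e); rewrite -!mulgA -fE -gE ff0.
have [p pE] : ldiv m (f0 * f2).
  by apply: mmin => //; [exists f2 | exists g2].
by exists p; apply: (@itv_mulIl m); rewrite -hE mulgA -pE -mulgA -fE ff0.
Qed.

Lemma right_has_inf_sup : has_inf_sup [set: M] rdiv.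
Proof.
apply: (@has_inf_sup_of_inf _ _ _ mu) => //.
- by move=> f _; exists 1; rewrite mul1g.
- by move=> f g h _ _ _; apply: rdiv_trans.
- move=> f g _ _ [c ->]; rewrite muM => cl.
  by exists 1; rewrite (@mu_eq0 c) ?mul1g //; lia.
- by move=> f g _ _; apply: right_gcd_ex.
- move=> f g _ _; have [N [fN gN]] := divides_common_Delta_pow f g.
  have [c fc] := divides_Delta_pow_left fN.
  have [c' gc] := divides_Delta_pow_left gN.
  by exists (Delta ^+ N); split=> //; [exists c | exists c'].
Qed.

Lemma itv_garside_monoid : garside_monoid Delta.
Proof.
split; last split.
- exists mu => [f g|g g1 /mu_eq0//]; by rewrite muM.
- by move=> h f g k /itv_mulIr/itv_mulIl.
- exact: left_has_inf_sup.
- exact: right_has_inf_sup.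
- apply/seteqP; split=> m.
    by move=> /left_divisors_Delta/right_divisors_Delta.
  by move=> /right_divisors_Delta/left_divisors_Delta.
- move=> m; elim/itv_monoid_ind: m => [|a m Pa [s sP ->]].
    by exists [::]; rewrite ?big_nil.
  exists (simple a :: s); last by rewrite big_cons.
  move=> h; rewrite inE => /predU1P[->|/sP//].
  by apply/left_divisors_Delta; exists a.
Qed.

Theorem interval_garside : interval_garside_monoid X w.
Proof.
split=> //; [exact: itv_lattice | exact: itv_r_lattice|].
exact: itv_garside_monoid.
Qed.

Theorem interval_simples :
  set_bij [set: itv X w] (left_divisors Delta) (@under G X w).
Proof.
split.
- move=> v _; apply/left_divisors_Delta; exists (val v); first exact: itv_val.
  by rewrite simple_val.
- move=> u v _ _; rewrite -!simple_val => uv; apply: val_inj.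
  exact: simple_inj (itv_val u) (itv_val v) uv.
- move=> m /left_divisors_Delta[a /itv_elt[v <-] ->].
  by exists v => //; rewrite simple_val.
Qed.

Theorem interval_fractions :
  exists (H : groupType) (iota : M -> H), is_group_of_fractions iota.
Proof.
apply: (group_of_fractions_ex itv_mulIl itv_mulIr phi_mul _ mul_Delta).
  by move=> a; exists (phiV a); apply: phiVK.
exact: divides_Delta_pow.
Qed.

End Interval.

(** * Monomial matrices in coordinates *)

Section Monomial.
Variables (L : fieldType) (n : nat) (x : L).
Hypothesis n2 : (2 <= n)%N.
Hypothesis x0 : (x != 0)%R.
Hypothesis x_inf : forall m : int, (x ^ m = 1)%R -> m = 0%R.

Local Notation W := (ginf n x).
Local Notation X := (@ginf_gen L n x).

Lemma prod_exprz (e : 'I_n -> int) : (\prod_i x ^ e i = x ^ (\sum_i e i))%R.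
Proof.
symmetry; apply: (big_morph (fun m : int => x ^ m)%R) => // p q.
exact: expfzDr.
Qed.

Lemma coord_ex (v : W) : exists es : ('I_n -> int) * 'S_n,
  val v = dperm_mx (fun i => x ^ es.1 i)%R es.2 /\ (\sum_i es.1 i = 0)%R.
Proof.
have /ginf_predP[d [s [vE _ dx d1]]] := valP v.
have [e eE] := fin_all_exists dx.
have {}vE : val v = dperm_mx (fun i => x ^ e i)%R s.
  by rewrite vE; congr dperm_mx; apply/funext.
exists (e, s); split=> //; apply: x_inf; rewrite -[RHS]d1.
by rewrite -prod_exprz; apply: eq_bigr => i _; rewrite eE.
Qed.

Definition gexp (v : W) : 'I_n -> int := (sval (cid (coord_ex v))).1.
Definition gperm (v : W) : 'S_n := (sval (cid (coord_ex v))).2.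

Lemma val_coord v : val v = dperm_mx (fun i => x ^ gexp v i)%R (gperm v).
Proof. by case: (svalP (cid (coord_ex v))). Qed.

Lemma sum_gexp v : (\sum_i gexp v i = 0)%R.
Proof. by case: (svalP (cid (coord_ex v))). Qed.

Lemma coord_inj (e e' : 'I_n -> int) (s s' : 'S_n) :
  dperm_mx (fun i => x ^ e i)%R s = dperm_mx (fun i => x ^ e' i)%R s' ->
  s = s' /\ e =1 e'.
Proof.
move=> /matrixP E.
have ss' i : s' i = s i.
  have := E i (s i); rewrite !mxE eqxx mulr1n; case: eqP => // _ /eqP.
  by rewrite mulr0n (negbTE (expfz_neq0 _ x0)).
split=> [|i]; first by apply/permP=> i; rewrite ss'.
have := E i (s i); rewrite !mxE ss' eqxx !mulr1n => xe.
by apply/subr0_eq/x_inf; rewrite expfzDr // xe -expfzDr // subrr.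
Qed.

Lemma coordP v e s : val v = dperm_mx (fun i => x ^ e i)%R s ->
  gperm v = s /\ gexp v =1 e.
Proof. by rewrite val_coord => /coord_inj. Qed.

Lemma coord_make (e : 'I_n -> int) s : (\sum_i e i = 0)%R ->
  exists v, gperm v = s /\ gexp v =1 e.
Proof.
move=> e0; have vP : ginf_pred x (dperm_mx (fun i => x ^ e i)%R s).
  apply/ginf_predP; exists (fun i => x ^ e i)%R, s; split=> //.
  - by move=> i; apply: expfz_neq0.
  - by move=> i; exists (e i).
  - by rewrite prod_exprz e0.
by exists (Ginf vP); apply: coordP.
Qed.

Lemma ginf_eq v v' : gperm v = gperm v' -> gexp v =1 gexp v' -> v = v'.
Proof.
move=> vs ve; apply: val_inj; rewrite !val_coord vs; congr dperm_mx.
by apply/funext => i; rewrite ve.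
Qed.

Lemma coordM v v' : gperm (v * v') = gperm v * gperm v' /\
  forall i, gexp (v * v') i = (gexp v i + gexp v' (gperm v i))%R.
Proof.
apply: coordP; rewrite (_ : val (v * v') = (val v *m val v')%R) //.
rewrite (val_coord v) (val_coord v') dperm_mxM.
by congr dperm_mx; apply/funext => i; rewrite expfzDr.
Qed.

Lemma gpermM v v' : gperm (v * v') = gperm v * gperm v'.
Proof. by case: (coordM v v'). Qed.

Lemma gexpM v v' i : gexp (v * v') i = (gexp v i + gexp v' (gperm v i))%R.
Proof. by case: (coordM v v'). Qed.

Lemma coord1 : gperm (1 : W) = 1 /\ gexp (1 : W) =1 (fun=> 0%R).
Proof.
apply: coordP; apply/matrixP=> i j; rewrite !mxE perm1.
by rewrite expr0z.
Qed.

Lemma gperm1 : gperm (1 : W) = 1. Proof. by case: coord1. Qed.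
Lemma gexp1 i : gexp (1 : W) i = 0%R. Proof. by case: coord1. Qed.

Lemma gpermV v : gperm v^-1 = (gperm v)^-1.
Proof. by apply/esym/mulg1_eq; rewrite -gpermM mulgV gperm1. Qed.

Lemma gexpV v i : gexp v^-1 (gperm v i) = (- gexp v i)%R.
Proof.
apply/eqP; rewrite eq_sym eqr_oppLR -addr_eq0.
by rewrite -gexpM mulgV gexp1.
Qed.

(** ** Generators *)

(** The rows a and b = a + 1 are exchanged, with a twist by [m] that can be
    nontrivial for the first two rows only: the generators are the t_m and the
    s_j alike. *)
Definition row_swap (a b : 'I_n) (m : int) (g : W) : Prop :=
  [/\ b = a.+1 :> nat, m <> 0%R -> a = 0%N :> nat, gperm g = tperm a b
    & forall i, gexp g i =
        if i == a then (- m)%R else if i == b then m else 0%R].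

Lemma neq_succ (a b : 'I_n) : b = a.+1 :> nat -> (b == a) = false.
Proof. by move=> ba; apply/eqP => /(congr1 val) /=; rewrite ba; lia. Qed.

Lemma row_swap_ex (a b : 'I_n) m : b = a.+1 :> nat ->
  (m <> 0%R -> a = 0%N :> nat) -> exists g, row_swap a b m g.
Proof.
move=> ba ma.
have [|g [gs ge]] := @coord_make
  (fun i => if i == a then (- m)%R else if i == b then m else 0%R) (tperm a b).
  have nba := neq_succ ba.
  rewrite (bigD1 a) //= eqxx (bigD1 b) /= nba // eqxx big1 ?addr0 ?addNr //.
  by move=> i /andP[/negbTE-> /negbTE->].
by exists g; split.
Qed.

Lemma ginf_genP g : X g <-> exists a b m, row_swap a b m g.
Proof.
have tE (a b : 'I_n) m : b = a.+1 :> nat -> a = 0%N :> nat ->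
    t_mx n x m = dperm_mx (fun i => x ^
      (if i == a then (- m)%R else if i == b then m else 0%R))%R (tperm a b).
  move=> ba az; have nba := neq_succ ba; apply/matrixP => i j; rewrite !mxE.
  have -> : (i == 0%N :> nat) = (i == a) by rewrite -val_eqE /= az.
  have -> : (j == 0%N :> nat) = (j == a) by rewrite -val_eqE /= az.
  have -> : (i == 1%N :> nat) = (i == b) by rewrite -val_eqE /= ba az.
  have -> : (j == 1%N :> nat) = (j == b) by rewrite -val_eqE /= ba az.
  case: tpermP => [->|->|/eqP/negbTE ia /eqP/negbTE ib].
  - by rewrite eqxx (eq_sym a b) nba (eq_sym b j) az /=; case: eqP.
  - by rewrite eqxx nba (eq_sym a j) ba az /=; case: eqP.
  - rewrite ia ib /= expr0z.
    suff -> : (1 < i)%N by [].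
    by move: ia ib; rewrite -!val_eqE /= ba az; lia.
have sE (a b : 'I_n) : b = a.+1 :> nat -> tperm_mx a b =
    dperm_mx (fun i => x ^
      (if i == a then (- 0)%R else if i == b then 0 else 0%R))%R (tperm a b).
  move=> ba; apply/matrixP => i j; rewrite !mxE.
  by rewrite oppr0 !if_same expr0z.
split.
  move=> [[m gE]|[a [b [a0 ba gE]]]].
    pose a := Ordinal (ltnW n2); pose b := Ordinal n2.
    exists a, b, m; rewrite (tE a b) // in gE.
    by have [gs ge] := coordP gE; split.
  exists a, b, 0%R; rewrite sE // in gE.
  by have [gs ge] := coordP gE; split.
move=> [a [b [m [ba ma gs ge]]]].
have gE : val g = dperm_mx (fun i => x ^
    (if i == a then (- m)%R else if i == b then m else 0%R))%R (tperm a b).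
  by rewrite val_coord gs; congr dperm_mx; apply/funext => i; rewrite ge.
have [a0|a0] := posnP a; first by left; exists m; rewrite gE -tE.
have m0 : m = 0%R by have [//|/eqP/ma] := eqVneq m 0%R; lia.
by right; exists a, b; split=> //; rewrite gE m0 -sE.
Qed.

Section RowSwap.
Variables (a b : 'I_n) (m : int) (g : W).
Hypothesis gP : row_swap a b m g.

Lemma gexp_swap_l : gexp g a = (- m)%R.
Proof. by case: gP => _ _ _ ->; rewrite eqxx. Qed.

Lemma gexp_swap_r : gexp g b = m.
Proof. by case: gP => ba _ _ ->; rewrite eqxx neq_succ. Qed.

Lemma gexp_swap_out i : i != a -> i != b -> gexp g i = 0%R.
Proof. by case: gP => _ _ _ -> /negbTE-> /negbTE->. Qed.

Lemma gperm_mul_l v : gperm (g * v) a = gperm v b.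
Proof. by case: gP => _ _ gs _; rewrite gpermM permM gs tpermL. Qed.

Lemma gperm_mul_r v : gperm (g * v) b = gperm v a.
Proof. by case: gP => _ _ gs _; rewrite gpermM permM gs tpermR. Qed.

Lemma gperm_mul_out v i : i != a -> i != b -> gperm (g * v) i = gperm v i.
Proof.
by case: gP => _ _ gs _ ia ib; rewrite gpermM permM gs tpermD // eq_sym.
Qed.

Lemma gexp_mul_l v : gexp (g * v) a = (gexp v b - m)%R.
Proof. by case: gP => _ _ gs _; rewrite gexpM gs tpermL gexp_swap_l addrC. Qed.

Lemma gexp_mul_r v : gexp (g * v) b = (gexp v a + m)%R.
Proof. by case: gP => _ _ gs _; rewrite gexpM gs tpermR gexp_swap_r addrC. Qed.

Lemma gexp_mul_out v i : i != a -> i != b -> gexp (g * v) i = gexp v i.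
Proof.
move=> ia ib; case: gP => _ _ gs _.
by rewrite gexpM gs tpermD 1?eq_sym // gexp_swap_out // add0r.
Qed.

Definition coord_mulE := (gperm_mul_l, gperm_mul_r, gexp_mul_l, gexp_mul_r).
End RowSwap.

Lemma ginf_eq_rows v v' :
  (forall i, gperm v i = gperm v' i /\ gexp v i = gexp v' i) -> v = v'.
Proof.
by move=> E; apply: ginf_eq => [|i]; [apply/permP => i|]; have [] := E i.
Qed.

Lemma row_swapK a b m g : row_swap a b m g -> g * g = 1.
Proof.
move=> gP; apply: ginf_eq_rows => i; rewrite gperm1 perm1 gexp1.
have [ba _ gs ge] := gP.
have [->|ia] := eqVneq i a.
  by rewrite (gperm_mul_l gP) (gexp_mul_l gP) gs tpermR (gexp_swap_r gP) subrr.
have [->|ib] := eqVneq i b.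
  by rewrite (gperm_mul_r gP) (gexp_mul_r gP) gs tpermL (gexp_swap_l gP) addNr.
rewrite (gperm_mul_out gP) // (gexp_mul_out gP) // (gexp_swap_out gP) //.
by rewrite gs tpermD // eq_sym.
Qed.

Lemma row_swapV a b m g : row_swap a b m g -> g^-1 = g.
Proof. by move=> /row_swapK/mulg1_eq. Qed.

(** ** Length *)

(** Putting the rows i < j into their final state takes one exchange if they form
    an inversion. If they do not, a power of x in the lower row can only be
    removed by two exchanges. *)
Definition pair_len (v : W) (i j : 'I_n) : nat :=
  (if gperm v j < gperm v i then 1 else if gexp v j == 0%R then 0 else 2)%N.

Definition coord_len (v : W) : nat :=
  (\sum_(p : 'I_n * 'I_n | (p.1 < p.2)%N) pair_len v p.1 p.2)%N.

(** Exchanging adjacent rows permutes the pairs of rows other than the exchanged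
    one. The twist only concerns the first two rows, neither of which is the
    lower row of another pair. *)
Lemma coord_len_swap a b m g v : row_swap a b m g ->
  (coord_len (g * v)%g + pair_len v a b =
   coord_len v + pair_len (g * v)%g a b)%N.
Proof.
move=> gP; have [ba ma gs ge] := gP; have ab : (a < b)%N by rewrite ba.
rewrite /coord_len (bigD1 (a, b)) //= [X in _ = (X + _)%N](bigD1 (a, b)) //=.
suff -> : (\sum_(p : 'I_n * 'I_n | (p.1 < p.2) && (p != (a, b)))
    pair_len (g * v)%g p.1 p.2 =
  \sum_(p : 'I_n * 'I_n | (p.1 < p.2) && (p != (a, b))) pair_len v p.1 p.2)%N.
  by rewrite addnC addnCA addnC.
pose t := tperm a b; pose tt (p : 'I_n * 'I_n) := (t p.1, t p.2).
have ttK : involutive tt by move=> [i j]; rewrite /tt /= !tpermK.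
rewrite [RHS](reindex_inj (inv_inj ttK)) /=; apply: eq_big => [[i j]|[i j]] /=.
  rewrite /tt /= !xpair_eqE /=.
  case: (tpermP a b i) => [->|->|/eqP + /eqP];
    case: (tpermP a b j) => [->|->|/eqP + /eqP];
    rewrite -?val_eqE /= ?ba; lia.
move=> /andP[ij ijab]; rewrite /pair_len /tt /= !gpermM !permM gexpM gs.
suff -> : gexp g j = 0%R by rewrite add0r.
rewrite ge; case: eqP => [ja|_].
  by have [->|/eqP/ma] := eqVneq m 0%R; [rewrite oppr0 | rewrite ja in ij; lia].
case: eqP => // jb; have [//|/eqP/ma az] := eqVneq m 0%R.
case/eqP: ijab; rewrite jb; congr pair; apply: val_inj; rewrite /= az.
by rewrite jb ba az in ij; lia.
Qed.

(** Whether exchanging the rows a and b with the twist m shortens v. *)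
Definition descent (v : W) (a b : 'I_n) (m : int) : bool :=
  if (gperm v b < gperm v a)%N then (gexp v a + m == 0)%R else gexp v b != 0%R.

Lemma coord_len_descent a b m g v : row_swap a b m g ->
  if descent v a b m then coord_len v = (coord_len (g * v)).+1
  else coord_len (g * v) = (coord_len v).+1.
Proof.
move=> gP; have := coord_len_swap v gP.
rewrite /pair_len !(coord_mulE gP) /descent.
have : gperm v a != gperm v b :> nat.
  by rewrite val_eqE (inj_eq perm_inj) eq_sym neq_succ //; case: gP.
set p := coord_len (g * v); set q := coord_len v; clearbody p q.
by case: ltngtP => // _ _; case: eqP => _ /=; lia.
Qed.

Lemma coord_len1 : coord_len 1 = 0%N.
Proof.
rewrite /coord_len big1 // => p pp; rewrite /pair_len gperm1 !perm1 gexp1 eqxx.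
by rewrite ltnNge ltnW.
Qed.

(** Without descents the rows are in order, first by the choice of the twist for
    the first two rows, then downwards, and no row carries a power of x. *)
Lemma descent_ex v : v <> 1 ->
  exists a b m g, row_swap a b m g /\ descent v a b m.
Proof.
move=> v1; apply: contrapT => none.
have nodesc (a b : 'I_n) m : b = a.+1 :> nat -> (m <> 0%R -> a = 0%N :> nat) ->
    ~~ descent v a b m.
  move=> ba ma; apply/negP => d; have [g gP] := row_swap_ex ba ma.
  by apply: none; exists a, b, m, g.
have rows j (jn : (j.+1 < n)%N) :
    (gperm v (Ordinal (ltnW jn)) < gperm v (Ordinal jn))%N /\
    gexp v (Ordinal jn) = 0%R.
  elim: j jn => [|j IH] jn.
    have := @nodesc (Ordinal (ltnW jn)) (Ordinal jn)
      (- gexp v (Ordinal (ltnW jn)))%R erefl (fun=> erefl).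
    rewrite /descent addrN eqxx; case: ltngtP => //= [_ /negPn/eqP//|].
    by move=> /val_inj/perm_inj/(congr1 val).
  have [_ e0] := IH (ltnW jn).
  have := @nodesc (Ordinal (ltnW jn)) (Ordinal jn) 0%R erefl.
  rewrite /descent e0 addr0 eqxx => /(_ (fun h => False_ind _ (h erefl))).
  case: ltngtP => //= [_ /negPn/eqP//|].
  by move=> /val_inj/perm_inj/(congr1 val) /=; lia.
have up : forall i : 'I_n, (i <= gperm v i)%N.
  case; elim=> // i IH iN; have [lt _] := rows i iN.
  exact: leq_ltn_trans (IH (ltnW iN)) lt.
have down : forall i : 'I_n, (gperm v i <= i)%N.
  move=> i; have [k] := ubnP (n - i); elim: k i => // k IH i ik.
  have [iN|iN] := ltnP i.+1 n; last first.
    by rewrite -ltnS; apply: leq_trans iN.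
  have [lt _] := rows i iN.
  have := IH (Ordinal iN); rewrite (_ : Ordinal (ltnW iN) = i) in lt.
    by move=> /= IHi; rewrite -ltnS; apply: leq_trans lt (IHi _); lia.
  exact: val_inj.
have s1 : gperm v = 1.
  apply/permP => i; rewrite perm1; apply: val_inj; apply/eqP.
  by rewrite eqn_leq up down.
have e0 (i : 'I_n) : (0 < i)%N -> gexp v i = 0%R.
  by case: i => -[//|i] iN _; have [_ vi] := rows i iN.
apply: v1; apply: ginf_eq => [|i]; first by rewrite gperm1.
rewrite gexp1; have [i0|/e0//] := posnP i.
have := sum_gexp v; rewrite (bigD1 i) //= big1 ?addr0 // => j ji.
by apply: e0; move: ji; rewrite -val_eqE /= i0; lia.
Qed.

Lemma has_word_coord_len v : has_word X v (coord_len v).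
Proof.
move: {-1}(coord_len v) (erefl (coord_len v)) => N.
elim: N v => [|N IH] v vN; have [v1|/descent_ex[a [b [m [g [gP vd]]]]]] :=
  pselect (v = 1).
- by exists [::]; rewrite big_nil v1.
- by have := coord_len_descent v gP; rewrite vd vN.
- by move: vN; rewrite v1 coord_len1.
have := coord_len_descent v gP; rewrite vd vN => -[gvN].
rewrite -[v]mul1g -(row_swapK gP) -mulgA; apply: has_word_cons.
  by apply/ginf_genP; exists a, b, m.
exact: IH.
Qed.

Lemma ginf_generated v : exists m, has_word X v m.
Proof. by exists (coord_len v); apply: has_word_coord_len. Qed.

Lemma coord_len_word v m : has_word X v m -> (coord_len v <= m)%N.
Proof.
move=> [s [<- sX <-]]; elim: s sX => [|g s IH] sX.
  by rewrite big_nil coord_len1.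
rewrite big_cons /=; have /ginf_genP[a [b [m' gP]]] : X g.
  by apply: sX; rewrite inE eqxx.
have {}IH : (coord_len (\prod_(h <- s) h)%g <= size s)%N.
  by apply: IH => h hs; apply: sX; rewrite inE hs orbT.
have := coord_len_descent (\prod_(h <- s) h) gP.
move: IH; set p := coord_len (\prod_(h <- s) h).
set q := coord_len (g * _); set r := size s; clearbody p q r.
by case: ifP => _; lia.
Qed.

(** Every nontrivial element has a descent, which lowers [coord_len] by one, and
    no generator changes it by more than one. *)
Lemma len_coord v : len X v = coord_len v.
Proof.
have [vw vmin] := len_spec ginf_generated v.
apply/eqP; rewrite eqn_leq vmin; last exact: has_word_coord_len.
exact: coord_len_word.
Qed.

Lemma len_ginfV v : len X v^-1 = len X v.
Proof.
apply: (len_inv ginf_generated) => g Xg.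
by have [a [b [m /row_swapV->]]] := (ginf_genP g).1 Xg.
Qed.

Lemma len_descent a b m g v : row_swap a b m g -> descent v a b m ->
  len X v = (len X (g * v)).+1.
Proof.
by move=> gP vd; have := coord_len_descent v gP; rewrite vd !len_coord.
Qed.

Lemma len_row_swap a b m g : row_swap a b m g -> len X g = 1%N.
Proof.
move=> gP; have := coord_len_descent 1 gP.
have [ba _ _ _] := gP.
by rewrite /descent gperm1 !perm1 !gexp1 ba ltnNge leqnSn ?eqxx /= mulg1
  coord_len1 len_coord.
Qed.

Lemma preceq_descent a b m g v : row_swap a b m g ->
  preceq X g v <-> descent v a b m.
Proof.
move=> gP; rewrite /preceq (row_swapV gP) (len_row_swap gP) !len_coord.
have := coord_len_descent v gP.
set p := coord_len (g * v); set q := coord_len v; clearbody p q.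
by case: ifP => _ pq; split=> //; lia.
Qed.

(** ** The interval of a power of lambda *)

Section Lambda.
Variables (w : W) (k : int).
Hypothesis k0 : k <> 0%R.
Hypothesis wperm : gperm w = 1.
Hypothesis wexp : forall i : 'I_n, (0 < i)%N -> gexp w i = k.

Local Notation le := (preceq X).

(** The quotients have the same permutation, and their exponents in a row differ
    only by the row of [w] that contributes. For the lower row of a pair in order
    both candidates are below the first row, where [w] has the exponent [k]. *)
Lemma len_quotient v : len X (v^-1 * w) = len X (w * v^-1).
Proof.
rewrite !len_coord; apply: eq_bigr => -[i j] /= ij; rewrite /pair_len.
rewrite !gpermM !permM wperm !perm1 !gexpM wperm perm1.
case: ltngtP => // [ji|/val_inj/perm_inj ijE]; last by rewrite ijE ltnn in ij.
have j0 := leq_ltn_trans (leq0n _) ij.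
by rewrite !wexp ?(addrC k) //; apply: leq_ltn_trans (leq0n _) ji.
Qed.

Lemma lambda_balanced : balanced X w.
Proof.
by apply/seteqP; split=> v; rewrite /itv /itv_r /= /preceq /preceq_r
  len_quotient addnC.
Qed.

(** The lengths of v and of w^-1 v add up to at least two for each pair of rows,
    which is the contribution of that pair to the length of [w]; as the lengths
    add up to that of [w], there is equality for each pair. *)
Lemma itv_gexp v (i j : 'I_n) : itv X w v -> (i < j)%N ->
  (gperm v i < gperm v j)%N -> gexp v j != 0%R -> gexp v j = k.
Proof.
rewrite /itv /= /preceq -(len_ginfV (v^-1 * w)) invgM invgK !len_coord.
move=> vw ij vij vj; apply: contrapT => vjk.
have wE (p : 'I_n * 'I_n) : (p.1 < p.2)%N -> pair_len w p.1 p.2 = 2.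
  move=> pp; have p20 := leq_ltn_trans (leq0n _) pp.
  by rewrite /pair_len wperm !perm1 ltnNge (ltnW pp) /= wexp //; case: eqP.
have uE (a b : 'I_n) : (0 < b)%N -> pair_len (w^-1 * v) a b =
    (if gperm v b < gperm v a then 1 else if gexp v b == k then 0 else 2)%N.
  move=> b0; rewrite /pair_len gexpM gpermM gpermV wperm invg1 mul1g perm1.
  have := gexpV w b; rewrite wperm perm1 => ->.
  by rewrite wexp // addrC subr_eq0.
have ge2 (p : 'I_n * 'I_n) : (p.1 < p.2)%N ->
    (pair_len w p.1 p.2 <=
     pair_len v p.1 p.2 + pair_len (w^-1 * v)%g p.1 p.2)%N.
  move=> pp; have p20 := leq_ltn_trans (leq0n _) pp.
  rewrite wE // uE // /pair_len; case: ifP => // _.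
  by case: eqP => [->|//]; case: eqP => // /esym.
suff : (coord_len w < coord_len w)%N by rewrite ltnn.
rewrite -[X in (_ < X)%N]vw /coord_len -big_split /= (bigD1 (i, j)) //=.
rewrite [X in (_ < X)%N](bigD1 (i, j)) //= -addSn; apply: leq_add.
  have j0 := leq_ltn_trans (leq0n _) ij.
  have nji : (gperm v j < gperm v i)%N = false by rewrite ltnNge ltnW.
  by rewrite (wE (i, j)) // uE // /pair_len nji (negbTE vj); case: eqP.
by apply: leq_sum => p /andP[pp _]; apply: ge2.
Qed.

(** Two factorisations of [z] of total length [r] are geodesic as soon as removing
    [z] from some [v] shortens it by [r]. *)
Lemma sup_of_factors r v z g p h q : z = g * p -> z = h * q ->
  (len X g + len X p <= r)%N -> (len X h + len X q <= r)%N ->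
  (r + len X (z^-1 * v)%g <= len X v)%N -> [/\ le g z, le h z & le z v].
Proof.
move=> zgp zhq gp hq zv.
have := len_mul ginf_generated g p; have := len_mul ginf_generated h q.
have := len_mul ginf_generated z (z^-1 * v).
rewrite mulVKg -zgp -zhq => l1 l2 l3.
have [zg zh] : g^-1 * z = p /\ h^-1 * z = q by rewrite {1}zgp zhq !mulKg.
by rewrite /preceq zg zh; split; len_lia.
Qed.

(** The supremum is read off from the rows of [v] that the two generators touch;
    only for two twists of the same pair of rows does it depend on [w]. *)
Lemma local_sup g h : X g -> X h -> exists z, forall v, itv X w v ->
  le g v -> le h v -> [/\ le g z, le h z & le z v].
Proof.
move=> /ginf_genP[a [b [m gP]]] /ginf_genP[a' [b' [m' hP]]].
wlog aa : g a b m gP h a' b' m' hP / (a <= a')%N.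
  move=> wl; have [|/ltnW] := leqP a a'; first exact: wl gP _ _ _ _ hP.
  move=> /(wl _ _ _ _ hP _ _ _ _ gP)[z zP]; exists z => v vw gv hv.
  by have [] := zP v vw hv gv.
have [ba ma gs ge] := gP; have [ba' ma' hs he] := hP.
have lens := (len_row_swap gP, len_row_swap hP).
have [aE|aN] := eqVneq a a'.
  have bE : b = b' by apply: val_inj; rewrite /= ba ba' aE.
  subst a' b'; have [mE|mN] := eqVneq m m'.
    exists g => v _ gv _; split=> //; first exact: preceq_refl.
    suff -> : h = g by apply: preceq_refl.
    by apply: ginf_eq => [|i]; rewrite ?hs ?gs // he ge mE.
  have a0 : a = 0%N :> nat.
    have [m0|/eqP/ma//] := eqVneq m 0%R.
    by apply: ma' => m'0; rewrite m0 m'0 eqxx in mN.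
  have nba := neq_succ ba.
  (* If two different twists are both descents of v, its first two rows are in
     order and the second one carries a power of x, which is x^k because v lies
     in the interval. Then t_m t_(m-k), independent of m, is below v. *)
  have [p pP] := @row_swap_ex a b (m - k)%R ba (fun=> a0).
  have [q qP] := @row_swap_ex a b (m' - k)%R ba (fun=> a0).
  have gpq : g * p = h * q.
    apply: ginf_eq_rows => i; rewrite !gpermM gs hs.
    have [_ _ ps pe] := pP; have [_ _ qs qe] := qP; rewrite ps qs; split=> //.
    rewrite !gexpM gs hs ge he pe qe.
    case: tpermP => [->|->|/eqP/negbTE ia /eqP/negbTE ib]; last first.
      by rewrite ia ib.
      by rewrite !eqxx !nba; lia.
    by rewrite !eqxx !nba; lia.
  exists (g * p) => v vw /(preceq_descent _ gP) gv /(preceq_descent _ hP) hv.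
  have [vab vb] : (gperm v a < gperm v b)%N /\ gexp v b != 0%R.
    move: gv hv mN; rewrite /descent.
    have : gperm v a != gperm v b :> nat.
      by rewrite val_eqE (inj_eq perm_inj) eq_sym nba.
    by case: ltngtP => // _ _ /eqP + /eqP; lia.
  have vbk : gexp v b = k by apply: (@itv_gexp v a b) => //; rewrite ba.
  have pv : descent (g * v) a b (m - k)%R.
    by rewrite /descent !(coord_mulE gP) vab vbk; lia.
  have l1 := len_descent gP gv; have l2 := len_descent pP pv.
  apply: (@sup_of_factors 2) gpq _ _ _ => //.
  - by rewrite lens (len_row_swap pP).
  - by rewrite lens (len_row_swap qP).
  by rewrite invgM (row_swapV gP) (row_swapV pP) -mulgA; len_lia.
have {aN} aN : (a < a')%N by rewrite ltn_neqAle aN.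
have a'0 : (0 < a')%N by lia.
have m'0 : m' = 0%R by have [//|/eqP/ma'] := eqVneq m' 0%R; lia.
have nba := neq_succ ba; have nba' := neq_succ ba'.
have [ab' bb'] : b' != a /\ b' != b by rewrite -!val_eqE /=; split; lia.
have [a'b|a'b] := eqVneq a' b.
  (* Consecutive pairs of rows: the three rows of v are reversed by g h g. *)
  subst a'; have h0 i : gexp h i = 0%R by rewrite he m'0 oppr0 !if_same.
  have braid : g * (h * g) = h * (g * h).
    apply: ginf_eq_rows => i; rewrite !gpermM !permM !gexpM gs hs.
    rewrite !h0 !add0r addr0.
    have tba : tperm b b' a = a by rewrite tpermD ?nba.
    have tab' : tperm a b b' = b' by rewrite tpermD // eq_sym.
    have gb' := gexp_swap_out gP ab' bb'.
    have [->|ia] := eqVneq i a.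
      by rewrite tba !tpermL tab' gb' addr0.
    have [->|ib] := eqVneq i b.
      rewrite !tpermR tba !tpermL tab' tpermR gb'.
      by rewrite (gexp_swap_l gP) (gexp_swap_r gP) subrr.
    have [->|ib'] := eqVneq i b'.
      by rewrite tab' !tpermR tba gb' add0r.
    rewrite !tpermD 1?eq_sym // (gexp_swap_out gP ia ib).
    by rewrite addr0.
  exists (g * (h * g)) => v vw.
  move=> /(preceq_descent _ gP) gv /(preceq_descent _ hP) hv.
  have hgv : descent (g * v) b b' m'.
    move: gv hv; rewrite /descent !(coord_mulE gP).
    rewrite (gperm_mul_out gP v ab' bb') (gexp_mul_out gP v ab' bb') m'0 !addr0.
    by case: ifP => ?; case: ifP => ?; case: ifP => ?; lia.
  have ghgv : descent (h * (g * v)) a b m.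
    move: hv; rewrite /descent !(coord_mulE hP).
    have nab : a != b by rewrite eq_sym nba.
    have nab' : a != b' by rewrite eq_sym.
    rewrite (gperm_mul_out hP) // (gexp_mul_out hP) //.
    rewrite (gperm_mul_out gP v ab' bb') (gexp_mul_out gP v ab' bb').
    rewrite !(coord_mulE gP) m'0.
    by rewrite subr0 addr0 subrK.
  have l1 := len_descent gP gv; have l2 := len_descent hP hgv.
  have l3 := len_descent gP ghgv.
  apply: (@sup_of_factors 3) (erefl _) braid _ _ _.
  - by have := len_mul ginf_generated h g; case: lens => -> ->; len_lia.
  - by have := len_mul ginf_generated g h; case: lens => -> ->; len_lia.
  by rewrite !invgM (row_swapV gP) (row_swapV hP) -!mulgA; len_lia.
(* Disjoint pairs of rows. *)
have [[na'a na'b] [naa' nab'] [nba1 nbb']] :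
    [/\ a' != a /\ a' != b, a != a' /\ a != b' & b != a' /\ b != b'].
  by move: a'b; rewrite -!val_eqE /=; split; split; lia.
have gh : g * h = h * g.
  apply: ginf_eq_rows => i; rewrite !gpermM !permM !gexpM gs hs.
  case: (tpermP a b i) => [->|->|/eqP ia /eqP ib].
  - rewrite !(tpermD (x := a')) // tpermL.
    by rewrite !(gexp_swap_out hP) // addr0 add0r.
  - rewrite !(tpermD (x := a')) // tpermR.
    by rewrite !(gexp_swap_out hP) // addr0 add0r.
  case: (tpermP a' b' i) => [->|->|/eqP ia' /eqP ib'].
  - rewrite tpermD //.
    by rewrite !(gexp_swap_out gP) // addr0 add0r.
  - rewrite tpermD //.
    by rewrite !(gexp_swap_out gP) // addr0 add0r.
  by rewrite tpermD 1?[_ == i]eq_sym // addrC.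
exists (g * h) => v vw /(preceq_descent _ gP) gv /(preceq_descent _ hP) hv.
have hgv : descent (g * v) a' b' m'.
  move: hv; rewrite /descent !(gperm_mul_out gP) //.
  by rewrite !(gexp_mul_out gP) //.
have l1 := len_descent gP gv; have l2 := len_descent hP hgv.
apply: (@sup_of_factors 2) (erefl _) gh _ _ _; rewrite ?lens //.
by rewrite invgM (row_swapV gP) (row_swapV hP) -mulgA; len_lia.
Qed.

Lemma lambda_infs a b : itv X w a -> itv X w b ->
  exists d, is_inf (itv X w) le a b d.
Proof.
exact: (inf_of_local_sup ginf_generated lambda_balanced local_sup).
Qed.

End Lambda.

Lemma coord_lambda : gperm (lambda n x) = 1 /\
  forall i : 'I_n, (0 < i)%N -> gexp (lambda n x) i = 1%R.
Proof.
have lE : val (lambda n x) = dperm_mx (fun i : 'I_n =>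
    x ^ (if i == 0%N :> nat then - n.-1%:Z else 1))%R 1.
  rewrite val_lambda ?(ltnW n2) //; apply/matrixP => i j; rewrite !mxE perm1.
  case: (eqVneq i j) => [->|_] /=; rewrite ?mulr0n //.
  by case: ifP; rewrite ?exprnN ?expr1z.
have [ls le] := coordP lE; split=> // i i0.
by rewrite le; case: eqP i0 => // ->.
Qed.

Lemma coord_expgn v m : gperm v = 1 ->
  gperm (v ^+ m) = 1 /\ forall i, gexp (v ^+ m) i = (gexp v i *+ m)%R.
Proof.
move=> v1; elim: m => [|m [IHs IHe]].
  by rewrite expg0; split=> [|i]; rewrite ?gperm1 ?gexp1.
rewrite expgS; split=> [|i]; first by rewrite gpermM v1 IHs mul1g.
by rewrite gexpM v1 perm1 IHe mulrS.
Qed.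

Lemma coord_expgz v k : gperm v = 1 ->
  gperm (expgz v k) = 1 /\ forall i, gexp (expgz v k) i = (gexp v i *~ k)%R.
Proof.
move=> v1; case: k => m /=; first exact: coord_expgn.
have [ms me] := coord_expgn m.+1 v1; split=> [|i].
  by rewrite gpermV ms invg1.
by have := gexpV (v ^+ m.+1) i; rewrite ms perm1 => ->; rewrite me.
Qed.

End Monomial.

(** A transcendental element is nonzero and has infinite multiplicative order:
    otherwise it would be a root of X or of some X^m - 1. *)
Lemma transcendental_exprz (K L : fieldType) (f : {rmorphism K -> L}) (x : L) :
  ~ algebraicOver f x -> (x != 0)%R /\ forall m : int, (x ^ m = 1)%R -> m = 0%R.
Proof.
move=> xtr; have x_nat m : (0 < m)%N -> (x ^+ m <> 1)%R.
  move=> m0 xm; apply: xtr; exists ('X^m - 1%:P)%R.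
    by rewrite -size_poly_eq0 size_XnsubC.
  rewrite rmorphB /= map_polyXn map_polyC /= rmorph1 rootE.
  by rewrite !hornerE ?hornerXn xm subrr.
split=> [|[[//|m]|m] xm].
- apply/eqP => x_0; apply: xtr; exists 'X%R; first by rewrite polyX_eq0.
  by rewrite map_polyX rootX x_0.
- by case: (x_nat m.+1).
- case: (x_nat m.+1) => //; apply: invr_inj; rewrite invr1; exact: xm.
Qed.

(** * The interval monoid of a power of lambda *)

Local Open Scope ring_scope.

Theorem theorem4p24 (K L : fieldType) (f : {rmorphism K -> L}) (x : L)
    (hx : ~ algebraicOver f x) (n : nat) (hn : (2 <= n)%N)
    (k : int) (hk : k <> 0) :
  let X := @ginf_gen L n x in
  let w := expgz (@lambda L n x) k in
  [/\ interval_garside_monoid X w,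
      set_bij [set: itv X w] (left_divisors (under (itv_top X w)))
        (@under _ X w)
    & exists (H : groupType) (iota : itv_monoid X w -> H),
        is_group_of_fractions iota].
Proof.
move=> X w; have [x0 x_inf] := transcendental_exprz hx.
have [l1 lexp] := coord_lambda hn x0 x_inf.
have [w1 wexp] := coord_expgz k l1.
have {}wexp (i : 'I_n) : (0 < i)%N -> gexp x0 x_inf w i = k.
  by move=> i0; rewrite wexp lexp // intz.
have gen := ginf_generated hn x0 x_inf.
have bal := lambda_balanced hn w1 wexp.
have infs := lambda_infs hn hk w1 wexp.
split.
- exact: interval_garside gen bal infs.
- exact: interval_simples gen bal infs.
- exact: interval_fractions gen bal infs.
Qed.
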